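(* Let $N\ge 1$. For all $\alpha<-2$ there exist a smooth initial datum $m_0:\mathbb{T}^N\to\mathbb{R}$ and a sequence of positive numbers $T_k\to0$ such that, for every $k$, the linear backward-forward system $$\begin{cases} -u_t-\Delta u=0 & \text{in }\mathbb{T}^N\times(0,T),\\ m_t-\Delta m=\Delta u & \text{in }\mathbb{T}^N\times(0,T),\\ u(x,T)=\alpha\,m(x,T),\quad m(x,0)=m_0(x) & \text{in }\mathbb{T}^N \end{cases}$$ with $T=T_k$ is not solvable, i.e. has no solution $(u,m)$ on $[0,T_k]$.
   Context: $\mathbb{T}^N=\mathbb{R}^N/\mathbb{Z}^N$ is the flat torus and $Q_T=\mathbb{T}^N\times(0,T)$. A solution means a pair $u,m\in W^{2,1}_p(Q_T)$ with $p>N+2$ (the parabolic Sobolev space of functions in $L^p(Q_T)$ with weak derivatives $u_t,Du,D^2u\in L^p(Q_T)$) satisfying the differential equations a.e. in $Q_T$ and the initial/final conditions for the continuous representatives. No sign condition is imposed on $m$ or $m_0$. *)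

(* Defs.v *)
From HB Require Import structures.
From mathcomp Require Import all_boot all_order all_algebra.
From mathcomp Require Import all_classical all_reals all_analysis.

Set Implicit Arguments.
Unset Strict Implicit.
Unset Printing Implicit Defensive.

Import Order.TTheory GRing.Theory Num.Theory.
Import numFieldNormedType.Exports.

Local Open Scope classical_set_scope.
Local Open Scope ring_scope.

(* The product (= Borel) sigma-algebra on row vectors: the one generated by the
   coordinates, as the library does for tuples. *)
Section measurable_row.
Context {d} {T : sigmaRingType d}.
Variable n : nat.

Let coord (i : 'I_n) (x : 'rV[T]_n) : T := x ord0 i.

Let row_set0 : g_sigma_preimage coord set0.
Proof. exact: sigma_algebra0. Qed.

Let row_setC A : g_sigma_preimage coord A -> g_sigma_preimage coord (~` A).
Proof. exact: sigma_algebraC. Qed.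

Let row_bigcup (F : (set 'rV[T]_n)^nat) :
  (forall i, g_sigma_preimage coord (F i)) ->
  g_sigma_preimage coord (\bigcup_i (F i)).
Proof. exact: sigma_algebra_bigcup. Qed.

HB.instance Definition _ := @isMeasurable.Build (measure_tuple_display d)
  'rV[T]_n (g_sigma_preimage coord) row_set0 row_setC row_bigcup.

End measurable_row.

Section torus_measure.
Context {R : realType}.

Definition cons_row n (z : measurableTypeR R * 'rV[R]_n) : 'rV[R]_(1 + n) :=
  row_mx (z.1 : R)%:M z.2.

Lemma measurable_cons_row n : measurable_fun setT (@cons_row n).
Proof.
apply: (@measurability _ _ _ _ _ _
  (\big[setU/set0]_(i < 1 + n) preimage_set_system setT
     (fun x : 'rV[R]_(1 + n) => x ord0 i) measurable)) => //.
rewrite -bigcup_mkord_ord => _ [_ [i _ [A mA <-]] <-].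
rewrite !setTI; case: (splitP (inord i : 'I_(1 + n))) => j ij.
- have -> : cons_row (n:=n) @^-1` ((fun x => x ord0 (inord i)) @^-1` A) =
      fst @^-1` A.
    have -> : inord i = lshift n j by exact: val_inj.
    by apply/seteqP; split=> -[x y] /=; rewrite /cons_row /= row_mxEl !ord1 mxE.
  rewrite -[X in measurable X]setTI.
  exact: (@measurable_fst _ _ (measurableTypeR R) 'rV[R]_n).
- have -> : cons_row (n:=n) @^-1` ((fun x => x ord0 (inord i)) @^-1` A) =
      snd @^-1` ((fun x : 'rV[R]_n => x ord0 j) @^-1` A).
    have -> : inord i = rshift 1 j by exact: val_inj.
    by apply/seteqP; split=> -[x y] /=; rewrite /cons_row /= row_mxEr.
  rewrite -[X in measurable X]setTI.
  apply: (@measurable_snd _ _ (measurableTypeR R) 'rV[R]_n) => //.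
  apply: sub_sigma_algebra; case: n j {ij} => [[]//|n] j.
  rewrite -bigcup_mkord_ord; exists j => //=.
  by exists A => //; rewrite inord_val setTI.
Qed.

HB.instance Definition _ n :=
  isMeasurableFun.Build _ _ _ _ (@cons_row n) (@measurable_cons_row n).

(* Lebesgue measure on T^n = R^n / Z^n, carried by the unit cube [0, 1]^n, a
   fundamental domain up to a null set. *)
Fixpoint torus_measure n : probability 'rV[R]_n R :=
  match n with
  | 0 => \d_(0 : 'rV[R]_0)
  | n'.+1 => distribution (uniform_prob (@ltr01 R) \x torus_measure n')%E
               (@cons_row n')
  end.

End torus_measure.

Section smooth.
Context {R : realType} {V : normedModType R}.

Definition iter_derive (s : seq V) (f : V -> R) : V -> R :=
  foldr (fun v g => 'D_v g) f s.

(* On a finite-dimensional V this is C^oo: every iterated directional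
   derivative exists and is continuous. *)
Definition smooth (f : V -> R) : Prop :=
  forall s : seq V, continuous (iter_derive s f) /\
    (forall v x, derivable (iter_derive s f) x v).

End smooth.

(* Functions on T^N are functions on R^N with period 1 in each coordinate;
   functions on T^N x (0, T) are functions of (x, t) in R^N * R with period 1 in
   each coordinate of x, whose values outside 0 < t < T are irrelevant. *)
Section parabolic_sobolev.
Context {R : realType} {N : nat}.
Implicit Types (T p : R) (f g u phi : 'rV[R]_N * R -> R).

Definition torus_periodic (f : 'rV[R]_N -> R) : Prop :=
  forall i, periodic f (delta_mx ord0 i).

Definition e_x (i : 'I_N) : 'rV[R]_N * R := (delta_mx ord0 i, 0).
Definition e_t : 'rV[R]_N * R := (0, 1).

Definition space_periodic f : Prop := forall i, periodic f (e_x i).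

Definition cylinder T : set ('rV[R]_N * measurableTypeR R) :=
  [set: 'rV[R]_N] `*` `]0, T[.

Lemma measurable_cylinder T : measurable (cylinder T).
Proof. by apply: measurableX => //; exact: measurable_itv. Qed.

Definition cylinder_measure T :=
  mrestr (torus_measure N \x (@lebesgue_measure R))%E (measurable_cylinder T).

HB.instance Definition _ T := Measure.on (cylinder_measure T).

Definition Lp_cylinder T p f : Prop :=
  space_periodic f /\ f \in Lfun (cylinder_measure T) p%:E.

Definition test_function T phi : Prop :=
  [/\ smooth phi, space_periodic phi &
      exists a b : R, [/\ 0 < a, b < T &
        forall x t, ~~ (a <= t <= b) -> phi (x, t) = 0]].

(* g is the weak derivative of f on T^N x (0, T) successively along the
   directions in s. *)
Definition weak_derivative T (s : seq ('rV[R]_N * R)) f g : Prop :=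
  forall phi, test_function T phi ->
    \int[cylinder_measure T]_z (f z * iter_derive s phi z) =
    (-1) ^+ size s * \int[cylinder_measure T]_z (g z * phi z).

(* u belongs to W^{2,1}_p, with weak derivatives u_t = ut, D_i u = Du i and
   D_ij u = D2u i j. *)
Record W21p T p u ut (Du : 'I_N -> 'rV[R]_N * R -> R)
    (D2u : 'I_N -> 'I_N -> 'rV[R]_N * R -> R) : Prop := {
  W21p_Lp : Lp_cylinder T p u ;
  W21p_dt_Lp : Lp_cylinder T p ut ;
  W21p_dx_Lp : forall i, Lp_cylinder T p (Du i) ;
  W21p_dxx_Lp : forall i j, Lp_cylinder T p (D2u i j) ;
  W21p_dt : weak_derivative T [:: e_t] u ut ;
  W21p_dx : forall i, weak_derivative T [:: e_x i] u (Du i) ;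
  W21p_dxx : forall i j, weak_derivative T [:: e_x i; e_x j] u (D2u i j)
}.

Definition laplacian (D2u : 'I_N -> 'I_N -> 'rV[R]_N * R -> R) z : R :=
  \sum_(i < N) D2u i i z.

(* v is the representative of u that is continuous on T^N x [0, T]. *)
Definition continuous_representative T u v : Prop :=
  [/\ space_periodic v,
      {within [set z | 0 <= z.2 <= T], continuous v} &
      {ae cylinder_measure T, forall z, u z = v z}].

Definition solution alpha (m0 : 'rV[R]_N -> R) T p u m : Prop :=
  exists ut Du D2u mt Dm D2m,
    [/\ W21p T p u ut Du D2u, W21p T p m mt Dm D2m,
        {ae cylinder_measure T, forall z, - ut z - laplacian D2u z = 0},
        {ae cylinder_measure T, forall z,
           mt z - laplacian D2m z = laplacian D2u z} &
        exists uc mc, [/\ continuous_representative T u uc,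
          continuous_representative T m mc,
          forall x, uc (x, T) = alpha * mc (x, T) &
          forall x, mc (x, 0) = m0 x]].

Definition solvable alpha (m0 : 'rV[R]_N -> R) T : Prop :=
  exists p u m, (N + 2)%:R < p /\ solution alpha m0 T p u m.

End parabolic_sobolev.

(* Main.v *)
Require Import Defs.
From mathcomp Require Import all_boot all_order all_algebra.
From mathcomp Require Import all_classical all_reals all_analysis.
From mathcomp Require Import measurable_realfun ring lra.

Set Implicit Arguments.
Unset Strict Implicit.
Unset Printing Implicit Defensive.

Import Order.TTheory GRing.Theory Num.Theory.
Import numFieldNormedType.Exports.

Local Open Scope classical_set_scope.
Local Open Scope ring_scope.

(** Expand along the eigenfunction cos(2 pi k x_1) of the Laplacian, with
    eigenvalue -lam, lam = (2 pi k)^2.  The coefficients of a solution satisfy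
    u_k' = lam u_k and m_k' = - lam m_k - lam u_k, so that

      exp(lam t) m_k(t) + sinh(lam t) u_k(t)

    does not depend on t.  At t = 0 it is the coefficient of m_0; at t = T the
    final condition u = alpha m makes it m_k(T) (exp(lam T) + alpha sinh(lam T)).
    When alpha < -2 the last factor vanishes at one positive time
    T = ln(alpha / (alpha + 2)) / (2 lam), and a solution on [0, T] forces the k-th
    coefficient of m_0 to vanish.  These times tend to 0 as k grows, hence it
    suffices to take a smooth m_0 with infinitely many nonzero coefficients.

    The datum is m_0(x) = 1 / (2 - cos(2 pi x_1)).  Its coefficients satisfy
    c_k = 4 c_(k+1) - c_(k+2) and c_0 > 0, so no two consecutive ones vanish
    (fourier_neq0).

    For weak solutions the conservation law is obtained by testing with separated
    functions h(t) cos(2 pi k x_1), which isolate one mode (conservation).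
    Taking for h multiples of a cut-off that rises near 0 and falls near T
    (plateau) compares averages of the conserved quantity near both ends; since
    the continuous representatives are uniformly close to their boundary values
    there (cube_uniform, Rintegral_concentrated), the conserved
    quantity takes the same value at 0 and at T (solvable_fourier_eq0). *)

(** * Smooth functions and directional derivatives *)

Section continuous_differentiability.
Context {R : realType}.

(** The order-by-order form of smoothness along directions: the recursion peels
    off the innermost derivative, so that closure under products, inverses and
    composition goes by induction on the order. *)
Fixpoint Cn {V : normedModType R} (n : nat) (f : V -> R) : Prop :=
  if n is n'.+1 then
    continuous f /\
    forall v, (forall x, derivable f x v) /\ Cn n' (fun x => 'D_v f x)
  else continuous f.

Section normed_module.
Context {V : normedModType R}.
Implicit Types (f g : V -> R) (n : nat) (x v : V).

Lemma Cn_continuous n f : Cn n f -> continuous f.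
Proof. by case: n => [|n] // []. Qed.

Lemma CnW n f : Cn n.+1 f -> Cn n f.
Proof.
elim: n f => [f []//|n IH f [cf df]].
by split=> // v; have [? ?] := df v; split=> //; exact: IH.
Qed.

Lemma Cn_smooth f : (forall n, Cn n f) -> smooth f.
Proof.
move=> Cf s.
suff Cs : forall n, Cn n (iter_derive s f).
  by split=> [|v x]; [exact: (Cs 0%N)|have [_ /(_ v)[]] := Cs 1%N].
by elim: s => [//|v s IH] n /=; have [_ /(_ v)[]] := IH n.+1.
Qed.

(** An exhibited family of directional derivatives carries the induction on the
    order. *)
Lemma CnS n f (f' : V -> V -> R) : continuous f ->
  (forall x v, is_derive x v f (f' v x)) -> (forall v, Cn n (f' v)) ->
  Cn n.+1 f.
Proof.
move=> cf df Cf'; split=> // v; split=> [x|].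
  exact: (@ex_derive _ _ _ _ _ _ _ (df x v)).
rewrite (_ : (fun x => 'D_v f x) = f' v)//.
by apply/funext => x; exact: derive_val.
Qed.

Lemma Cn_is_derive n f x v : Cn n.+1 f -> is_derive x v f ('D_v f x).
Proof. by move=> [_ /(_ v)[df _]]; exact: derivableP. Qed.

Lemma Cn_derive n f v : Cn n.+1 f -> Cn n (fun x => 'D_v f x).
Proof. by move=> [_ /(_ v)[]]. Qed.

Lemma Cn_cst n (c : R) : Cn n (fun _ : V => c).
Proof.
elim: n c => [c|n IH c]; first exact: cst_continuous.
apply: (@CnS _ _ (fun _ _ => 0)); first exact: cst_continuous.
by move=> v; exact: IH.
Qed.

Lemma CnD n f g : Cn n f -> Cn n g -> Cn n (fun x => f x + g x).
Proof.
elim: n f g => [|n IH] f g Cf Cg.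
  by move=> x; apply: cvgD; [exact: Cf|exact: Cg].
apply: (@CnS _ _ (fun v x => 'D_v f x + 'D_v g x)).
- by move=> x; apply: cvgD; [exact: (Cn_continuous Cf)|exact: (Cn_continuous Cg)].
- move=> x v; have ? := Cn_is_derive x v Cf; have ? := Cn_is_derive x v Cg.
  exact: is_deriveD.
- by move=> v; apply: IH; exact: Cn_derive.
Qed.

Lemma CnM n f g : Cn n f -> Cn n g -> Cn n (fun x => f x * g x).
Proof.
elim: n f g => [|n IH] f g Cf Cg.
  by move=> x; apply: cvgM; [exact: Cf|exact: Cg].
apply: (@CnS _ _ (fun v x => f x * 'D_v g x + g x * 'D_v f x)).
- by move=> x; apply: cvgM; [exact: (Cn_continuous Cf)|exact: (Cn_continuous Cg)].
- move=> x v; have ? := Cn_is_derive x v Cf; have ? := Cn_is_derive x v Cg.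
  exact: is_deriveM.
- by move=> v; apply: CnD; apply: IH; by [exact: CnW|exact: Cn_derive].
Qed.

Lemma CnV n f : (forall x, f x != 0) -> Cn n f -> Cn n (fun x => (f x)^-1).
Proof.
move=> f0; elim: n f f0 => [|n IH] f f0 Cf.
  by move=> x; apply: cvgV; [exact: f0|exact: Cf].
apply: (@CnS _ _ (fun v x => -1 * ((f x)^-1 * (f x)^-1) * 'D_v f x)).
- by move=> x; apply: cvgV; [exact: f0|exact: (Cn_continuous Cf)].
- move=> x v; have [df _] := Cn_is_derive x v Cf.
  apply: DeriveDef; first exact: derivableV.
  by rewrite deriveV// -invfM -expr2 mulN1r.
- move=> v; apply: CnM; last exact: Cn_derive.
  apply: CnM; first exact: Cn_cst.
  by apply: CnM; apply: IH => //; exact: CnW.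
Qed.

Lemma is_derive_linear (l : V -> R) x v :
  (forall h v x, l (h *: v + x) = h * l v + l x) -> is_derive x v l (l v).
Proof.
move=> lin.
have lcvg : h^-1 *: ((l \o shift x) (h *: v) - l x) @[h --> 0^'] --> l v.
  apply: cvg_near_cst; near=> h.
  have h0 : h != 0 by near: h; exact: nbhs_dnbhs_neq.
  by rewrite /= lin addrK /GRing.scale/= mulKf.
by apply: DeriveDef; [apply/cvg_ex; exists (l v)|exact: cvg_lim].
Unshelve. all: by end_near. Qed.

Lemma Cn_linear n (l : V -> R) : continuous l ->
  (forall h v x, l (h *: v + x) = h * l v + l x) -> Cn n l.
Proof.
case: n => [//|n] cl lin; apply: (@CnS _ _ (fun v _ => l v)) => //.
  by move=> x v; exact: is_derive_linear.
by move=> v; exact: Cn_cst.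
Qed.

(** The chain rule along a direction v reduces to the one-variable rule on the
    line t |-> t v + x. *)
Lemma is_derive_comp1 (h : R -> R) g x v (a b : R) :
  is_derive (g x) 1 h a -> is_derive x v g b ->
  is_derive x v (h \o g) (a * b).
Proof.
move=> dh dg.
have h1 : is_derive (g (0 *: v + x)) 1 h a by rewrite scale0r add0r.
have dline (k : V -> R) : 'D_v k x = 'D_1 (fun t : R => k (t *: v + x)) 0.
  apply: (congr1 (fun F : R -> R => lim (F @ 0^'))); apply/funext => t /=.
  by rewrite addr0 scale0r add0r [_%:A]mulr1.
have dg1 : is_derive (0 : R) 1 (fun t : R => g (t *: v + x)) b.
  by case: dg => dg gb; apply: DeriveDef; [exact/(derivable1P _ x v)|rewrite -dline].
have [dhg hgb] := @is_derive1_comp _ h (fun t : R => g (t *: v + x)) 0 _ _ h1 dg1.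
by apply: DeriveDef; [exact/(derivable1P _ x v)|rewrite dline].
Qed.


End normed_module.

Lemma Cn_comp (V : normedModType R) n (h : R -> R) (g : V -> R) :
  Cn n h -> Cn n g -> Cn n (fun x => h (g x)).
Proof.
elim: n h g => [|n IH] h g Ch Cg.
  by move=> x; apply: (@continuous_comp _ _ _ g h); [exact: Cg|exact: Ch].
apply: (@CnS _ _ _ (fun v x => 'D_1 h (g x) * 'D_v g x)).
- move=> x; apply: (@continuous_comp _ _ _ g h).
    exact: (Cn_continuous Cg).
  exact: (Cn_continuous Ch).
- move=> x v; have ? := Cn_is_derive x v Cg.
  case: Ch => _ /(_ 1)[/(_ (g x))/derivableP ? _].
  exact: is_derive_comp1.
- move=> v; apply: CnM; last exact: Cn_derive.
  apply: (IH (fun y => 'D_1 h y) g); last exact: CnW.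
  by case: Ch => _ /(_ 1)[].
Qed.

Lemma Cn1S n (f f' : R -> R) :
  (forall x : R, is_derive x 1 f (f' x)) -> Cn n f' -> Cn n.+1 f.
Proof.
move=> df Cf'; apply: (@CnS _ _ _ (fun v x => f' x * v)).
- by move=> x; apply/differentiable_continuous/derivable1_diffP; have [] := df x.
- by move=> x v; apply: (@is_derive_comp1 _ f id).
- by move=> v; apply: CnM => //; exact: Cn_cst.
Qed.

Lemma is_derive_scale (w t : R) : is_derive t 1 (fun t : R => w * t) w.
Proof.
apply: (is_derive_eq (is_deriveZ w (is_derive_id t 1))).
by rewrite /GRing.scale/= mulr1.
Qed.

Lemma Cn_id n : Cn n (fun x : R => x).
Proof. by apply: Cn_linear => [x|//]; exact: cvg_id. Qed.

Lemma Cn_expR n : Cn n (expR : R -> R).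
Proof.
elim: n => [|n IH]; first exact: continuous_expR.
by apply: (@Cn1S _ _ expR).
Qed.

Lemma Cn_sin_cos n : Cn n (sin : R -> R) /\ Cn n (cos : R -> R).
Proof.
elim: n => [|n [IHs IHc]]; first by
  split; [exact: continuous_sin|exact: continuous_cos].
split; first exact: (@Cn1S _ _ cos).
apply: (@Cn1S _ _ (fun x => -1 * sin x)) => [x|].
  by rewrite mulN1r; exact: is_derive_cos.
by apply: CnM => //; exact: Cn_cst.
Qed.

(** The functions x^-k exp(-1/x), extended by 0, form a family closed under
    differentiation up to linear combinations; k = 0 is the classical smooth
    function that vanishes exactly on the nonpositive half line. *)
Definition flat k (x : R) : R := if 0 < x then x^-1 ^+ k * expR (- x^-1) else 0.

Lemma flat_ge0 k x : 0 <= flat k x.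
Proof.
by rewrite /flat; case: ifPn => // x0; rewrite mulr_ge0 ?expR_ge0// exprn_ge0// invr_ge0 ltW.
Qed.

Lemma flat_gt0 k x : 0 < x -> 0 < flat k x.
Proof.
by move=> x0; rewrite /flat x0 mulr_gt0 ?expR_gt0// exprn_gt0// invr_gt0.
Qed.

(** With y = 1/x this is y^(k+1) <= (k+1)! exp(y), a single term of the
    exponential series; it gives the flatness at 0. *)
Lemma flat_le k x : 0 < x -> flat k x <= k.+1`!%:R * x.
Proof.
move=> x0; rewrite /flat x0 expRN.
have y0 : 0 < x^-1 by rewrite invr_gt0.
rewrite ler_pdivrMr ?expR_gt0//.
have := expR_ge1Dxn k (ltW y0); set e := expR _ => he.
have he' : x^-1 ^+ k.+1 / k.+1`!%:R <= e by apply: le_trans he; rewrite lerDr.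
move: he'; rewrite ler_pdivrMr ?ltr0n ?fact_gt0// => he'.
rewrite -(ler_pM2l y0) -exprS (le_trans he')// mulrC.
by rewrite -!mulrA [x * e]mulrC !mulrA [x^-1 * _]mulrC -!mulrA [x^-1 * _]mulrC mulfK ?gt_eqF.
Qed.

Lemma flat_is_derive k (x : R) :
  is_derive x 1 (flat k) (flat k.+2 x - k%:R * flat k.+1 x).
Proof.
have [x0|x0|->] := ltgtP x 0.
- have -> : flat k.+2 x - k%:R * flat k.+1 x = 0.
    by rewrite /flat ltNge (ltW x0)/= mulr0 subr0.
  apply: (@near_eq_is_derive _ _ _ (cst 0)).
  near=> y; rewrite /flat ifF//; apply/negbTE; rewrite -leNgt ltW//.
  by near: y; exact: lt_nbhsl.
- apply: (@near_eq_is_derive _ _ _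
    ((fun y : R => y^-1) ^+ k * (expR \o (fun y : R => - y^-1)))).
  + near=> y; have y0 : 0 < y by near: y; exact: lt_nbhsr.
    by rewrite /flat y0 exprfctE.
  + have dV : is_derive x 1 (fun y : R => y^-1) (- x ^- 2 *: 1).
      by apply: is_deriveV; rewrite ?gt_eqF.
    have dE : is_derive x 1 (expR \o (fun y : R => - y^-1))
        (expR (- x^-1) * (- (- x ^- 2 *: 1))).
      exact: is_derive1_comp.
    have dX := @is_deriveX R R (fun y : R => y^-1) k x 1 _ dV.
    apply: (@is_derive_eq R R R _ x 1 _ _ (@is_deriveM R R _ _ x 1 _ _ dX dE)).
    rewrite /flat x0 /= /GRing.scale /= mulr1.
    case: k {dX} => [|k]; rewrite !exprfctE !exprS ?expr0 -?exprVn /= !invfM invr1; ring.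
- have -> : flat k.+2 0 - k%:R * flat k.+1 0 = 0.
    by rewrite /flat ltxx/= mulr0 subr0.
(* At the origin the difference quotient of flat k is flat k.+1. *)
  have c0 : h^-1 *: ((flat k \o shift 0) (h *: 1) - flat k 0) @[h --> 0^'] --> (0 : R).
    apply: (@cvg_trans _ (flat k.+1 h @[h --> 0^'])).
      apply: near_eq_cvg; near=> h; rewrite /= addr0 [_%:A]mulr1 /flat ltxx subr0.
      case: ifP => _; rewrite ?scaler0// /GRing.scale/= exprS mulrA//.
    apply: (@squeeze_cvgr _ _ _ _ (fun=> 0) (fun h => k.+2`!%:R * `|h|)).
    - near=> h; rewrite flat_ge0/=; have [h0|h0] := ltP 0 h.
        by rewrite gtr0_norm// flat_le.
      by rewrite /flat ltNge h0/= mulr_ge0// ler0n.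
    - exact: cvg_cst.
    - rewrite -[X in _ --> X](mulr0 k.+2`!%:R); apply: cvgMr.
      rewrite -[X in _ --> X](@normr0 _ R); apply: cvg_norm.
      exact: cvg_within.
  by apply: DeriveDef; [apply/cvg_ex; exists 0|exact: cvg_lim].
Unshelve. all: by end_near. Qed.

Lemma Cn_flat n k : Cn n (flat k).
Proof.
elim: n k => [|n IH] k.
  move=> x; apply/differentiable_continuous/derivable1_diffP.
  by have [] := flat_is_derive k x.
apply: (Cn1S (flat_is_derive k)); under eq_fun do rewrite -mulNr.
by apply: CnD => //; apply: CnM => //; exact: Cn_cst.
Qed.
End continuous_differentiability.

(** * Smooth steps and time cut-offs *)

Section plateau.
Context {R : realType}.
Local Notation mu := (@lebesgue_measure R).

(** The open interval is the form in which time integrals over the cylinder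
    appear. *)
Lemma Rintegral_FTC (f F : R -> R) (a b : R) : a < b ->
  continuous f -> (forall x : R, is_derive x 1 F (f x)) ->
  \int[mu]_(x in `]a, b[) f x = F b - F a.
Proof.
move=> ab cf dF.
have cF : continuous F.
  by move=> x; apply/differentiable_continuous/derivable1_diffP; have [] := dF x.
have mf : measurable_fun `]a, b[ f.
  by apply: measurable_funTS; exact: continuous_measurable_fun.
rewrite /Rintegral -(@integral_itv_bndoo _ a b _ true false)//; last first.
  exact/measurable_EFinP.
rewrite (@continuous_FTC2 _ f F)//.
- exact: continuous_subspaceT.
- split.
  + by move=> x _; have [] := dF x.
  + exact/cvg_at_right_filter/cF.
  + exact/cvg_at_left_filter/cF.
- by move=> x _; rewrite derive1E; have [] := dF x.
Qed.

(** A smooth step: 0 on x <= 0 and 1 on x >= 1, since one of the two flat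
    functions vanishes there while their sum never does. *)
Definition step (x : R) : R := flat 0 x * (flat 0 x + flat 0 (1 - x))^-1.

(** The derivative of step, in a form whose sign and support are visible. *)
Definition dstep (x : R) : R :=
  (flat 2 x * flat 0 (1 - x) + flat 0 x * flat 2 (1 - x)) *
  ((flat 0 x + flat 0 (1 - x))^-1 * (flat 0 x + flat 0 (1 - x))^-1).

Lemma flat_eq0 k (x : R) : x <= 0 -> flat k x = 0.
Proof. by move=> x0; rewrite /flat ltNge x0. Qed.

Lemma step_den_gt0 (x : R) : 0 < flat 0 x + flat 0 (1 - x).
Proof.
have [x0|x0] := ltP 0 x; first by rewrite ltr_pwDl ?flat_gt0// flat_ge0.
by rewrite ltr_wpDl ?flat_ge0// flat_gt0// subr_gt0 (le_lt_trans x0).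
Qed.

Lemma Cn_1B n : Cn n (fun x : R => 1 - x).
Proof.
under eq_fun do rewrite -mulN1r.
by apply: CnD; [exact: Cn_cst|apply: CnM; [exact: Cn_cst|exact: Cn_id]].
Qed.

Lemma Cn_step_den n : Cn n (fun x : R => (flat 0 x + flat 0 (1 - x))^-1).
Proof.
apply: CnV => [x|]; first by rewrite gt_eqF// step_den_gt0.
apply: CnD; first exact: Cn_flat.
by apply: Cn_comp; [exact: Cn_flat|exact: Cn_1B].
Qed.

Lemma Cn_dstep n : Cn n dstep.
Proof.
have Cf k : Cn n (fun x : R => flat k (1 - x)).
  by apply: Cn_comp; [exact: Cn_flat|exact: Cn_1B].
by apply: CnM; [apply: CnD; apply: CnM => //; exact: Cn_flat|apply: CnM; exact: Cn_step_den].
Qed.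

Lemma is_derive_step (x : R) : is_derive x 1 step (dstep x).
Proof.
have df (y : R) : is_derive y 1 (flat 0) (flat 2 y).
  by apply: is_derive_eq; [exact: flat_is_derive|rewrite mul0r subr0].
have d1 : is_derive x 1 (fun x : R => 1 - x) (- 1).
  by apply: (is_derive_eq (is_deriveB (is_derive_cst (1 : R) x 1) (is_derive_id x 1)));
    rewrite sub0r.
have dg : is_derive x 1 (flat 0 \o (fun x : R => 1 - x)) (flat 2 (1 - x) * - 1).
  exact: is_derive1_comp.
have dh := is_deriveD (df x) dg.
have h0 : (flat 0 + (flat 0 \o (fun x : R => 1 - x))) x != 0.
  by rewrite gt_eqF//; exact: step_den_gt0.
have dV := is_deriveV h0 dh.
have dM := is_deriveM (df x) dV.
apply: (is_derive_eq dM).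
move: h0; rewrite /dstep /GRing.scale/= => h0.
rewrite !fctE /= in h0 *. by field.
Qed.

Lemma Cn_step n : Cn n step.
Proof. by apply: CnW; apply: (Cn1S is_derive_step); exact: Cn_dstep. Qed.

Lemma step_eq0 (x : R) : x <= 0 -> step x = 0.
Proof. by move=> x0; rewrite /step flat_eq0// mul0r. Qed.

Lemma step_eq1 (x : R) : 1 <= x -> step x = 1.
Proof.
move=> x1; rewrite /step [flat 0 (1 - x)]flat_eq0 ?subr_le0// addr0 divff//.
by rewrite gt_eqF// flat_gt0// (lt_le_trans ltr01).
Qed.

Lemma dstep_ge0 (x : R) : 0 <= dstep x.
Proof.
by rewrite mulr_ge0 ?addr_ge0 ?mulr_ge0 ?flat_ge0// invr_ge0 ltW// step_den_gt0.
Qed.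

Lemma dstep_eq0 (x : R) : ~~ (0 <= x <= 1) -> dstep x = 0.
Proof.
rewrite negb_and -!ltNge /dstep => /orP[|] x0.
  by rewrite !(@flat_eq0 _ x) ?(ltW x0)// !mul0r addr0 mul0r.
by rewrite !(@flat_eq0 _ (1 - x)) ?subr_le0 ?(ltW x0)// !mulr0 addr0 mul0r.
Qed.

(** A time cut-off equal to the difference of two smooth steps, one rising just
    after 0 and one rising just before T.  Its derivative is a mass-one bump
    near 0 minus a mass-one bump near T: testing a conserved quantity against it
    compares the initial value with the final one. *)
Lemma plateau (T d : R) : 0 < d -> 4 * d <= T ->
  exists psi rho0 rhoT : R -> R,
    [/\ forall n, Cn n psi,
        forall t, ~~ (d <= t <= T - d) -> psi t = 0,
        forall t : R, is_derive t 1 psi (rho0 t - rhoT t),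
        [/\ continuous rho0, forall t, 0 <= rho0 t,
            forall t, ~~ (d <= t <= 2 * d) -> rho0 t = 0 &
            \int[mu]_(t in `]0, T[) rho0 t = 1] &
        [/\ continuous rhoT, forall t, 0 <= rhoT t,
            forall t, ~~ (T - 2 * d <= t <= T - d) -> rhoT t = 0 &
            \int[mu]_(t in `]0, T[) rhoT t = 1]].
Proof.
move=> d0 dT.
pose s a (t : R) := step ((t - a) * d^-1).
pose r a (t : R) := dstep ((t - a) * d^-1) * d^-1.
have Caff n (a : R) : Cn n (fun t : R => (t - a) * d^-1).
  by apply: CnM; [apply: CnD; [exact: Cn_id|exact: Cn_cst]|exact: Cn_cst].
have Cs a n : Cn n (s a) by apply: Cn_comp; [exact: Cn_step|exact: Caff].
have Cr a n : Cn n (r a).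
  apply: CnM; last exact: Cn_cst.
  by apply: (Cn_comp (h := dstep)); [exact: Cn_dstep|exact: Caff].
have ds (a t : R) : is_derive t 1 (s a) (r a t).
  have da : is_derive t 1 (fun t : R => (t - a) * d^-1) d^-1.
    have -> : (fun t : R => (t - a) * d^-1) = d^-1 \*: (id - cst a).
      by apply/funext => y; rewrite /GRing.scale/= mulrC.
    by apply: is_derive_eq; rewrite subr0 /GRing.scale/= mulr1.
  exact: (is_derive1_comp (is_derive_step _) da).
have r0 a t : 0 <= r a t by rewrite mulr_ge0 ?dstep_ge0// invr_ge0 ltW.
have rs a t : ~~ (a <= t <= a + d) -> r a t = 0.
  move=> h; rewrite /r dstep_eq0 ?mul0r//; apply: contra h.
  by rewrite ler_pdivlMr// ler_pdivrMr// => /andP[]; lra.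
have s0 a t : t <= a -> s a t = 0.
  by move=> h; rewrite /s step_eq0// ler_pdivrMr//; lra.
have s1 a t : a + d <= t -> s a t = 1.
  by move=> h; rewrite /s step_eq1// ler_pdivlMr//; lra.
have ri a : 0 <= a -> a + d <= T -> \int[mu]_(t in `]0, T[) r a t = 1.
  move=> a0 aT; rewrite (@Rintegral_FTC _ (s a))//; last 2 first.
  - by lra.
  - exact: (Cn_continuous (Cr a 0%N)).
  by rewrite s1// s0// subr0.
(* The steps rise on [d, 2d] and [T - 2d, T - d]. *)
exists (fun t => s d t - s (T - 2 * d) t), (r d), (r (T - 2 * d)); split.
- move=> n; under eq_fun do rewrite -mulN1r.
  by apply: CnD => //; apply: CnM => //; exact: Cn_cst.
- move=> t; rewrite negb_and -!ltNge => /orP[h|h].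
    by rewrite !s0 ?subrr//; lra.
  by rewrite !s1 ?subrr//; lra.
- by move=> t; exact: is_deriveB.
- split => //; [exact: (Cn_continuous (Cr d 0%N))| |by apply: ri; lra].
  by move=> t h; apply: rs; apply: contra h => /andP[? ?]; apply/andP; split; lra.
- split => //; [exact: (Cn_continuous (Cr _ 0%N))| |by apply: ri; lra].
  by move=> t h; apply: rs; apply: contra h => /andP[? ?]; apply/andP; split; lra.
Qed.

End plateau.

(** * Integration on the torus *)

Section torus_integral.
Context {R : realType}.
Local Notation mu := (@lebesgue_measure R).

Lemma measurable_coord N (i : 'I_N) :
  measurable_fun [set: 'rV[R]_N] (fun x : 'rV[R]_N => x ord0 i).
Proof.
move=> _ A mA; apply: sub_sigma_algebra; case: N i => [[]//|n] i.
rewrite -bigcup_mkord_ord; exists i => //=.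
by exists A => //; rewrite inord_val.
Qed.

Lemma cons_row0 n (z : measurableTypeR R * 'rV[R]_n) :
  cons_row z ord0 (ord0 : 'I_n.+1) = z.1.
Proof.
have -> : (ord0 : 'I_n.+1) = lshift n (ord0 : 'I_1) by exact: val_inj.
by rewrite /cons_row row_mxEl mxE.
Qed.

Lemma cons_rowS n (z : measurableTypeR R * 'rV[R]_n) (i : 'I_n) :
  cons_row z ord0 (lift ord0 i : 'I_n.+1) = z.2 ord0 i.
Proof.
have -> : (lift ord0 i : 'I_n.+1) = rshift 1 i by exact: val_inj.
by rewrite /cons_row row_mxEr.
Qed.

Lemma torus_measureT n : torus_measure n [set: 'rV[R]_n] = 1%E.
Proof. exact: (@probability_setT _ _ _ (torus_measure n)). Qed.

Lemma bounded_torus_integrable n (f : 'rV[R]_n -> R) (M : R) :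
  measurable_fun setT f -> (forall x, `|f x| <= M) ->
  (torus_measure n).-integrable setT (EFin \o f).
Proof.
move=> mf fM; apply: measurable_bounded_integrable => //.
  have : (torus_measure n [set: 'rV[R]_n] < +oo)%E by rewrite torus_measureT ltry.
  by [].
exists M; split; first exact: num_real.
by move=> x x1 y _; exact: le_trans (fM y) (ltW x1).
Qed.

Lemma Rintegral_torus_cst n (c : R) : \int[torus_measure n]_x c = c.
Proof.
rewrite /Rintegral integral_cst//.
have -> : (c%:E * torus_measure n setT = c%:E * 1)%E.
  by congr (_ * _)%E; exact: torus_measureT.
by rewrite mule1.
Qed.

Definition cube n : set 'rV[R]_n := [set x | forall i, 0 <= x ord0 i <= 1].

Lemma measurable_cube n : measurable (@cube n).
Proof.
rewrite (_ : @cube n =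
    \bigcap_(i in [set: 'I_n]) ((fun x : 'rV[R]_n => x ord0 i) @^-1` [set t | 0 <= t <= 1]));
    last first.
  by apply/seteqP; split=> [x cx i _|x cx i]; [exact: cx|exact: (cx i)].
apply: fin_bigcap_measurable => // i _.
rewrite -[X in measurable X]setTI; apply: measurable_coord => //.
rewrite (_ : [set t : R | 0 <= t <= 1] = `[0, 1]%classic); first exact: measurable_itv.
by apply/seteqP; split=> t /=; rewrite in_itv.
Qed.

Lemma torus_measure_cube n : torus_measure n (@cube n) = 1%E.
Proof.
elim: n => [|n IH].
  by rewrite /= diracE mem_set// => -[].
rewrite /torus_measure -/torus_measure /=.
rewrite [LHS](_ : _ =
  (uniform_prob (@ltr01 R) \x torus_measure n)%E (`[0, 1]%classic `*` @cube n)); last first.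
  rewrite /distribution /pushforward/=; congr (_ _).
  apply/seteqP; split=> -[x y] /=; rewrite in_itv/=.
    move=> h; split; first by have := h ord0; rewrite cons_row0.
    by move=> i; have := h (lift ord0 i); rewrite cons_rowS.
  move=> [hx hy] i; case: (unliftP ord0 i) => [j ->|->].
    by rewrite cons_rowS.
  by rewrite cons_row0.
rewrite product_measure1E//=; last exact: measurable_cube.
by rewrite [X in (_ * X)%E]IH mule1 /uniform_prob integral_uniform_pdf1.
Qed.

(** The law of the first coordinate under the torus measure is uniform on
    [0, 1].  Nonnegativity lets Tonelli's theorem and the change of variables
    apply without integrability conditions. *)
Lemma ge0_Rintegral_torus_coord n (f : R -> R) : continuous f ->
  (forall x, 0 <= f x) ->
  \int[torus_measure n.+1]_x f (x ord0 ord0) = \int[mu]_(t in `]0, 1[) f t.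
Proof.
move=> cf f0.
have mf : measurable_fun setT f by exact: continuous_measurable_fun.
rewrite /Rintegral; congr fine.
rewrite -(@integral_itv_bndoo _ 0 1 _ true false); last first.
  by apply/measurable_EFinP; exact: measurable_funTS.
rewrite /torus_measure -/torus_measure.
rewrite ge0_integral_distribution//; last first.
- by move=> x; rewrite lee_fin.
- apply/measurable_EFinP; apply: (measurableT_comp mf).
  exact: (@measurable_coord n.+1).
rewrite [LHS](_ : _ =
   \int[(uniform_prob (@ltr01 R) \x torus_measure n)%E]_z (f z.1)%:E)%E; last first.
  apply: eq_integral => -[x y] _ /=; congr (f _)%:E.
  exact: cons_row0.
rewrite fubini_tonelli1//; last 2 first.
- apply/measurable_EFinP; apply: (measurableT_comp mf).
  exact: measurable_fst.
- by move=> z; rewrite lee_fin.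
rewrite /fubini_F /=.
rewrite (eq_integral (fun x : measurableTypeR R => (f x)%:E)); last first.
  move=> x _; rewrite integral_cst// -[RHS]mule1; congr (_ * _)%E.
  exact: torus_measureT.
rewrite integral_uniform//; last exact/measurable_EFinP.
by rewrite subr0 invr1 mul1e.
Qed.


(** The integral of 1 + cos, which is nonnegative, is computed by the fundamental
    theorem of calculus; the value for cos follows by subtraction. *)
Lemma Rintegral_torus_cos n (k : nat) : (0 < k)%N ->
  \int[torus_measure n.+1]_x cos (2 * pi * k%:R * x ord0 ord0) = 0 :> R.
Proof.
move=> k0; set w := 2 * pi * k%:R : R.
have w0 : w != 0 by rewrite !mulf_neq0// ?pnatr_eq0 ?gt_eqF// ?pi_gt0// ltr0n.
have cw : continuous (fun t : R => cos (w * t)).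
  move=> t; apply: (@continuous_comp _ _ _ ( *%R w) cos); last exact: continuous_cos.
  exact: mulrl_continuous.
have ic : (torus_measure n.+1).-integrable setT
    (EFin \o (fun x : 'rV[R]_n.+1 => cos (w * x ord0 ord0))).
  apply: (@bounded_torus_integrable _ _ 1).
  - apply: (measurableT_comp (continuous_measurable_fun cw)).
    exact: measurable_coord.
  - by move=> x; rewrite ler_norml cos_geN1 cos_le1.
have i1 : (torus_measure n.+1).-integrable setT (EFin \o (fun _ : 'rV[R]_n.+1 => 1 : R)).
  by apply: (@bounded_torus_integrable _ _ 1) => // x; rewrite normr1.
suff : \int[torus_measure n.+1]_x (1 + cos (w * x ord0 ord0)) = 1.
  rewrite RintegralD// Rintegral_torus_cst.
  by rewrite -[X in _ = X]addr0 => /addrI.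
rewrite (@ge0_Rintegral_torus_coord n (fun t => 1 + cos (w * t))); last 2 first.
- by move=> t; apply: cvgD; [exact: cvg_cst|exact: cw].
- by move=> t; have := cos_geN1 (w * t); lra.
have dF (t : R) : is_derive t 1 (fun t => t + w^-1 * sin (w * t)) (1 + cos (w * t)).
  have d1 := is_derive_scale w t.
  have d2 : is_derive t 1 (sin \o (fun t : R => w * t)) (cos (w * t) * w).
    exact: is_derive1_comp.
  apply: (is_derive_eq (is_deriveD (is_derive_id t 1) (is_deriveZ w^-1 d2))).
  by rewrite /GRing.scale/=; congr (_ + _); field.
rewrite (Rintegral_FTC ltr01 _ dF); last first.
  by move=> t; apply: cvgD; [exact: cvg_cst|exact: cw].
rewrite mulr0 sin0 mulr0 mulr1 addr0 subr0.
have -> : sin w = 0 :> R.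
  rewrite /w -[2]/(2%:R) mulr_natl mulr_natr.
  by rewrite -[X in sin X]add0r (periodicn (@sinD2pi R)) sin0.
by rewrite mulr0 addr0.
Qed.

End torus_integral.

(** * A datum with infinitely many nonzero Fourier coefficients *)

Section fourier.
Context {R : realType} {n : nat}.
Implicit Types k : nat.

Definition wave k (t : R) : R := cos (2 * pi * k%:R * t).

(** Up to a constant factor, the Poisson kernel of the unit disc at radius
    2 - sqrt 3.  The relation (2 - cos) * poisson = 1 turns into a three-term
    recurrence for its Fourier coefficients. *)
Definition poisson (t : R) : R := (2 - cos (2 * pi * t))^-1.

Definition fourier k : R :=
  \int[torus_measure n.+1]_x (poisson (x ord0 ord0) * wave k (x ord0 ord0)).

Lemma Cn_scale i (w : R) : Cn i (fun t : R => w * t).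
Proof. by apply: CnM; [exact: Cn_cst|exact: Cn_id]. Qed.

Lemma Cn_wave i k : Cn i (wave k).
Proof. by apply: Cn_comp; [have [] := @Cn_sin_cos R i|exact: Cn_scale]. Qed.

Lemma poisson_den_ge1 (t : R) : 1 <= 2 - cos (2 * pi * t).
Proof. by have := cos_le1 (2 * pi * t); lra. Qed.

Lemma Cn_poisson i : Cn i poisson.
Proof.
apply: CnV => [t|]; first by rewrite gt_eqF// (lt_le_trans ltr01)// poisson_den_ge1.
apply: CnD; first exact: Cn_cst.
under eq_fun do rewrite -mulN1r; apply: CnM; first exact: Cn_cst.
by apply: Cn_comp; [have [] := @Cn_sin_cos R i|exact: Cn_scale].
Qed.

Lemma poisson_bounds t : 3^-1 <= poisson t <= 1.
Proof.
have h1 := poisson_den_ge1 t; have h3 := cos_geN1 (2 * pi * t : R).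
have h0 : 0 < 2 - cos (2 * pi * t) by exact: lt_le_trans h1.
apply/andP; split; last by rewrite invf_le1.
by rewrite lef_pV2 ?posrE//; lra.
Qed.

Lemma normr_wave k t : `|wave k t| <= 1.
Proof. by rewrite ler_norml cos_geN1 cos_le1. Qed.

Lemma continuous_coord_measurable (f : R -> R) :
  continuous f -> measurable_fun setT (fun x : 'rV[R]_n.+1 => f (x ord0 ord0)).
Proof.
move=> cf; apply: (measurableT_comp (continuous_measurable_fun cf)).
exact: measurable_coord.
Qed.

Lemma continuous_poisson_wave k : continuous (fun t => poisson t * wave k t).
Proof.
by apply: (@Cn_continuous _ _ 0); apply: CnM; [exact: Cn_poisson|exact: Cn_wave].
Qed.

Lemma normr_poisson_wave k t : `|poisson t * wave k t| <= 1.
Proof.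
have /andP[h1 h2] := poisson_bounds t.
rewrite normrM -[leRHS]mulr1 ler_pM ?normr_wave//.
by rewrite ger0_norm//; lra.
Qed.

Lemma fourier_integrable k : (torus_measure n.+1).-integrable setT
  (EFin \o (fun x : 'rV[R]_n.+1 => poisson (x ord0 ord0) * wave k (x ord0 ord0))).
Proof.
apply: (@bounded_torus_integrable _ _ _ 1).
  exact: (continuous_coord_measurable (@continuous_poisson_wave k)).
by move=> x; exact: normr_poisson_wave.
Qed.

Lemma wave_integrable k : (torus_measure n.+1).-integrable setT
  (EFin \o (fun x : 'rV[R]_n.+1 => wave k (x ord0 ord0))).
Proof.
apply: (@bounded_torus_integrable _ _ _ 1).
  exact: (continuous_coord_measurable (Cn_continuous (Cn_wave 0 k))).
by move=> x; exact: normr_wave.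
Qed.

(** Multiply poisson * (2 - cos theta) = 1 by 2 cos((k+1) theta) and use
    cos(k theta) + cos((k+2) theta) = 2 cos(theta) cos((k+1) theta). *)
Lemma poisson_wave_rec k (t : R) : poisson t * wave k t =
  4 * (poisson t * wave k.+1 t) - poisson t * wave k.+2 t - 2 * wave k.+1 t.
Proof.
have h : poisson t * (2 - cos (2 * pi * t)) = 1.
  by rewrite mulVf// gt_eqF// (lt_le_trans ltr01)// poisson_den_ge1.
have h2 : wave k t + wave k.+2 t = 2 * cos (2 * pi * t) * wave k.+1 t.
  rewrite /wave.
  have -> : 2 * pi * k%:R * t = 2 * pi * k.+1%:R * t - 2 * pi * t :> R by rewrite -natr1; ring.
  have -> : 2 * pi * k.+2%:R * t = 2 * pi * k.+1%:R * t + 2 * pi * t :> R.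
    by rewrite -[in LHS]natr1; ring.
  by rewrite cosB cosD; ring.
have -> : wave k t = 2 * cos (2 * pi * t) * wave k.+1 t - wave k.+2 t by rewrite -h2 addrK.
move: h; set C := cos _; set K := poisson t => h.
have -> : K * (2 * C * wave k.+1 t - wave k.+2 t) =
  4 * (K * wave k.+1 t) - K * wave k.+2 t - 2 * wave k.+1 t * (K * (2 - C)) by ring.
by rewrite h mulr1.
Qed.

Lemma fourier_rec k : fourier k = 4 * fourier k.+1 - fourier k.+2.
Proof.
rewrite /fourier.
under eq_Rintegral do rewrite poisson_wave_rec.
have iZ := fun j (c : R) => integrableZl measurableT c (fourier_integrable j).
rewrite RintegralB//; last 2 first.
- exact: (integrableB measurableT (iZ k.+1 4) (fourier_integrable k.+2)).
- exact: (integrableZl measurableT 2 (wave_integrable k.+1)).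
rewrite RintegralB//; last 2 first.
- exact: (iZ k.+1 4).
- exact: fourier_integrable.
rewrite RintegralZl//; last exact: fourier_integrable.
rewrite RintegralZl//; last exact: wave_integrable.
by rewrite Rintegral_torus_cos// mulr0 subr0.
Qed.

Lemma fourier0_gt0 : 0 < fourier 0.
Proof.
apply: (@lt_le_trans _ _ 3^-1); first by rewrite invr_gt0.
rewrite -(Rintegral_torus_cst n.+1 3^-1); apply: le_Rintegral => //.
- apply: (@bounded_torus_integrable _ _ _ `|3^-1|) => //.
- exact: fourier_integrable.
- move=> x _; rewrite /wave mulr0 mul0r cos0 mulr1.
  by have /andP[] := poisson_bounds (x ord0 ord0).
Qed.

(** Two consecutive vanishing coefficients would, by running the recurrence
    downwards, make the mean of a positive function vanish. *)
Lemma fourier_neq0 k : exists2 j, (k < j)%N & fourier j != 0.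
Proof.
have [f1|f1] := eqVneq (fourier k.+1) 0; last by exists k.+1.
have [f2|f2] := eqVneq (fourier k.+2) 0; last by exists k.+2.
suff : fourier 0 = 0 by move=> f0; have := fourier0_gt0; rewrite f0 ltxx.
suff : forall i, (i <= k.+1)%N -> fourier (k.+1 - i) = 0 /\ fourier (k.+2 - i) = 0.
  by move=> /(_ k.+1 (leqnn _))[]; rewrite subnn.
elim=> [_|i IH ik]; first by rewrite !subn0.
have [g1 g2] := IH (ltnW ik).
rewrite !subSS; split; last exact: g1.
have ik' : (i <= k)%N by [].
rewrite fourier_rec -(subSn ik') -subSn ?leqW// g1 g2.
by rewrite mulr0 subr0.
Qed.

End fourier.

(** * Separated test functions on the cylinder *)

Section cylinder_measure.
Context {R : realType} {N : nat}.
Local Notation mu := (@lebesgue_measure R).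
Implicit Types (T a b : R).

(** The values on rectangles determine the cylinder measure: it is the product
    of the torus measure with Lebesgue measure restricted to the open time
    interval. *)
Lemma cylinder_measureX T (A : set 'rV[R]_N) (B : set (measurableTypeR R)) :
  measurable A -> measurable B ->
  cylinder_measure T (A `*` B) = (torus_measure N A * mu (B `&` `]0%R, T[))%E.
Proof.
move=> mA mB; rewrite /cylinder_measure /mrestr /=.
have -> : (A `*` B) `&` cylinder T = A `*` (B `&` `]0, T[%classic).
  by apply/seteqP; split=> [[x t] /= [[? ?] [_ ?]]//|[x t] /= [? [? ?]]].
rewrite product_measure1E//; apply: measurableI => //; exact: measurable_itv.
Qed.

Lemma cylinder_measureT T : (cylinder_measure T [set: 'rV[R]_N * measurableTypeR R] < +oo)%E.
Proof.
rewrite -setXTT cylinder_measureX// setTI torus_measureT mul1e.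
by rewrite lebesgue_measure_itv/=; case: ifP; rewrite ltry.
Qed.

Lemma bounded_cylinder_integrable T (f : 'rV[R]_N * measurableTypeR R -> R) (M : R) :
  measurable_fun setT f -> (forall z, `|f z| <= M) ->
  (cylinder_measure T).-integrable setT (EFin \o f).
Proof.
move=> mf fM; apply: measurable_bounded_integrable => //; first exact: cylinder_measureT.
exists M; split; first exact: num_real.
by move=> x x1 y _; exact: le_trans (fM y) (ltW x1).
Qed.

Lemma Lp_integrableM T (p : R) (f g : 'rV[R]_N * R -> R) (M : R) :
  1 <= p -> Lp_cylinder T p f -> measurable_fun setT g -> (forall z, `|g z| <= M) ->
  (cylinder_measure T).-integrable setT (EFin \o (fun z => f z * g z)).
Proof.
move=> p1 [_ fp] mg gM.
have f1 : f \in Lfun (cylinder_measure T) 1%E.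
  apply: (Lfun_subset _ _ _ _ fp) => //.
  by rewrite ge0_fin_numE//; exact: cylinder_measureT.
have /Lfun1_integrable fi := f1.
apply: (integrableMl measurableT fi mg).
exists M; split; first exact: num_real.
by move=> x x1 y _; exact: le_trans (gM y) (ltW x1).
Qed.

Definition tsupp a b (h : R -> R) : Prop :=
  continuous h /\ forall t, ~~ (a <= t <= b) -> h t = 0.

Lemma tsupp_bounded a b h : tsupp a b h -> exists M, forall t, `|h t| <= M.
Proof.
move=> [ch h0].
have [M [_ hM]] : bounded_set (h @` `[a, b]).
  apply: compact_bounded; apply: continuous_compact; last exact: segment_compact.
  exact: continuous_subspaceT.
exists (`|M| + 1) => t; have [tab|tab] := boolP (a <= t <= b).
  apply: (hM (`|M| + 1)); first by rewrite (le_lt_trans (ler_norm M))// ltrDl.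
  by exists t => //=; rewrite in_itv.
by rewrite h0// normr0 addr_ge0.
Qed.

Lemma tsuppM a b (g h : R -> R) :
  continuous g -> tsupp a b h -> tsupp a b (fun t => g t * h t).
Proof.
move=> cg [ch h0]; split=> [t|t tab]; last by rewrite h0// mulr0.
by apply: cvgM; [exact: cg|exact: ch].
Qed.

End cylinder_measure.

Section modes.
Context {R : realType} {n : nat}.
Local Notation N := n.+1.
Implicit Types (T a b lam p : R) (h e : R -> R).

(** The separated functions h(t) e(x_1), to which every weak derivative will be
    applied. *)
Definition mode h e (z : 'rV[R]_N * R) : R := h z.2 * e (z.1 ord0 ord0).

Lemma measurable_mode h e : continuous h -> continuous e ->
  measurable_fun [set: 'rV[R]_N * measurableTypeR R] (mode h e).
Proof.
move=> ch ce; apply: measurable_funM.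
- apply: (measurableT_comp (continuous_measurable_fun ch)); exact: measurable_snd.
- apply: (measurableT_comp (continuous_measurable_fun ce)).
  by apply: (measurableT_comp (@measurable_coord R N ord0)); exact: measurable_fst.
Qed.

Lemma mode_bounded a b h e (K : R) : tsupp a b h -> (forall t, `|e t| <= K) ->
  exists M, forall z, `|mode h e z| <= M.
Proof.
move=> /tsupp_bounded[M hM] eK; exists (M * K) => z.
by rewrite normrM ler_pM.
Qed.

Lemma continuous_coord0 : continuous (fun z : 'rV[R]_N * R => z.1 ord0 ord0).
Proof.
move=> z; apply: (@continuous_comp _ _ _ fst (fun x : 'rV[R]_N => x ord0 ord0)).
  exact: cvg_fst.
exact: coord_continuous.
Qed.

Lemma continuous_time : continuous (fun z : 'rV[R]_N * R => z.2).
Proof. by move=> z; exact: cvg_snd. Qed.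

Lemma Cn_mode k h e : Cn k h -> Cn k e -> Cn k (mode h e).
Proof.
move=> Ch Ce; apply: CnM; apply: Cn_comp => //; apply: Cn_linear.
- exact: continuous_time.
- by [].
- exact: continuous_coord0.
- by move=> c v x; rewrite /= !mxE.
Qed.

Lemma is_derive_mode h h' e e' (z v : 'rV[R]_N * R) :
  (forall t : R, is_derive t 1 h (h' t)) -> (forall t : R, is_derive t 1 e (e' t)) ->
  is_derive z v (mode h e) (mode h' e z * v.2 + mode h e' z * v.1 ord0 ord0).
Proof.
move=> dh de.
have d2 : is_derive z v (fun z : 'rV[R]_N * R => z.2) v.2 by exact: is_derive_linear.
have d1 : is_derive z v (fun z : 'rV[R]_N * R => z.1 ord0 ord0) (v.1 ord0 ord0).
  apply: (@is_derive_linear _ _ (fun z : 'rV[R]_N * R => z.1 ord0 ord0)).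
  by move=> c w x; rewrite /= !mxE.
have D1 := is_derive_comp1 (de _) d1.
have D2 := is_derive_comp1 (dh _) d2.
apply: (is_derive_eq (is_deriveM D2 D1)).
by rewrite /mode /GRing.scale/=; ring.
Qed.

Lemma derive_mode_t h h' e e' :
  (forall t : R, is_derive t 1 h (h' t)) -> (forall t : R, is_derive t 1 e (e' t)) ->
  iter_derive [:: e_t] (mode h e) = mode h' e.
Proof.
move=> dh de; apply/funext => z /=.
have D := is_derive_mode z e_t dh de; rewrite derive_val.
by rewrite /e_t /= mxE mulr1 mulr0 addr0.
Qed.

Lemma derive_mode_x h h' e e' (i : 'I_N) :
  (forall t : R, is_derive t 1 h (h' t)) -> (forall t : R, is_derive t 1 e (e' t)) ->
  iter_derive [:: e_x i] (mode h e) = mode (fun t => (i == ord0)%:R * h t) e'.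
Proof.
move=> dh de; apply/funext => z /=.
have D := is_derive_mode z (e_x i) dh de; rewrite derive_val.
by rewrite /e_x /= mxE eqxx mulr0 add0r [ord0 == i]eq_sym /mode; ring.
Qed.

(** In the form used by the Laplacian: among the pure second space derivatives
    only the one along the first coordinate survives. *)
Lemma derive_mode_xx h h' e e' e2 (i : 'I_N) :
  (forall t : R, is_derive t 1 h (h' t)) -> (forall t : R, is_derive t 1 e (e' t)) ->
  (forall t : R, is_derive t 1 e' (e2 t)) ->
  iter_derive [:: e_x i; e_x i] (mode h e) = fun z => (i == ord0)%:R * mode h e2 z.
Proof.
move=> dh de de'.
rewrite -[LHS]/(iter_derive [:: e_x i] (iter_derive [:: e_x i] (mode h e))).
rewrite (derive_mode_x _ dh de).
have dch (t : R) : is_derive t 1 (fun t => (i == ord0)%:R * h t) ((i == ord0)%:R * h' t).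
  exact: (is_deriveZ (i == ord0)%:R (dh t)).
rewrite (derive_mode_x _ dch de'); apply/funext => z; rewrite /mode !mulrA.
by case: (i == ord0); rewrite !(mulr0, mul0r, mul1r).
Qed.

Lemma mode_test_function T a b h e :
  0 < a -> b < T -> (forall k, Cn k h) -> tsupp a b h -> (forall k, Cn k e) -> periodic e 1 ->
  test_function T (mode h e).
Proof.
move=> a0 bT Ch [_ h0] Ce pe; split.
- by apply: Cn_smooth => k; exact: Cn_mode.
- move=> i [x t]; rewrite /mode /e_x /= !mxE addr0 eqxx /=.
  by case: eqP => _; rewrite ?pe ?addr0.
- by exists a, b; split=> // x t tab; rewrite /mode /= h0// mul0r.
Qed.

End modes.

(** * The equations along one Fourier mode *)

Section pairing.
Context {R : realType} {n : nat}.
Local Notation N := n.+1.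
Context (T p a b lam : R) (e e' : R -> R).
Context (p1 : 1 <= p) (a0 : 0 < a) (bT : b < T).
Context (Ce : forall k, Cn k e) (pe : periodic e 1).
Context (de : forall t : R, is_derive t 1 e (e' t)).
Context (de' : forall t : R, is_derive t 1 e' (- lam * e t)).
Context (K : R) (eK : forall t, `|e t| <= K).
Implicit Types (f g u m : 'rV[R]_N * R -> R) (h : R -> R).
Implicit Types (D2u D2m : 'I_N -> 'I_N -> 'rV[R]_N * R -> R).
Local Notation cyl := (cylinder_measure T).
Local Notation Lp := (Lp_cylinder T p).
Local Notation tsupp := (tsupp a b).

(** The weak form of the Fourier coefficient of f along e, tested in time
    against h. *)
Definition pairing f h : R := \int[cyl]_z (f z * mode h e z).

Lemma pairing_integrable f h : Lp f -> tsupp h ->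
  cyl.-integrable setT (EFin \o (fun z => f z * mode h e z)).
Proof.
move=> Lf bh; have [M hM] := @mode_bounded R n _ _ _ _ _ bh eK.
apply: (@Lp_integrableM _ _ _ _ _ _ M p1 Lf _ hM).
apply: measurable_mode; first by case: bh.
exact: (Cn_continuous (Ce 0%N)).
Qed.

Lemma pairingD f h1 h2 : Lp f -> tsupp h1 -> tsupp h2 ->
  pairing f (fun t => h1 t + h2 t) = pairing f h1 + pairing f h2.
Proof.
move=> Lf b1 b2; rewrite /pairing -RintegralD//; try exact: pairing_integrable.
by apply: eq_Rintegral => z _; rewrite /mode mulrDl mulrDr.
Qed.

Lemma pairingZ f h (c : R) : Lp f -> tsupp h ->
  pairing f (fun t => c * h t) = c * pairing f h.
Proof.
move=> Lf bh; rewrite /pairing -RintegralZl//; try exact: pairing_integrable.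
by apply: eq_Rintegral => z _; rewrite /mode -mulrA mulrCA.
Qed.

Lemma pairingB f h1 h2 : Lp f -> tsupp h1 -> tsupp h2 ->
  pairing f (fun t => h1 t - h2 t) = pairing f h1 - pairing f h2.
Proof.
move=> Lf b1 b2.
have -> : (fun t => h1 t - h2 t) = (fun t => h1 t + -1 * h2 t).
  by apply/funext => t; rewrite mulN1r.
rewrite pairingD// ?pairingZ ?mulN1r//.
by apply: (@tsuppM _ _ _ (fun=> -1)) => //; exact: cst_continuous.
Qed.

Lemma Rintegral_sum (I : Type) (s : seq I) (F : I -> 'rV[R]_N * R -> R) :
  (forall i, cyl.-integrable setT (EFin \o F i)) ->
  cyl.-integrable setT (EFin \o (fun z => \sum_(i <- s) F i z)) /\
  \int[cyl]_z (\sum_(i <- s) F i z) = \sum_(i <- s) \int[cyl]_z F i z.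
Proof.
move=> iF; elim: s => [|i s [IHi IH]].
  have -> : (fun z => \sum_(i <- [::]) F i z) = fun=> 0.
    by apply/funext => z; rewrite big_nil.
  split; first exact: (@integrable0 _ _ _ cyl).
  by rewrite big_nil /Rintegral integral0.
have -> : (fun z => \sum_(j <- i :: s) F j z) = fun z => F i z + \sum_(j <- s) F j z.
  by apply/funext => z; rewrite big_cons.
split; first exact: (integrableD measurableT (iF i) IHi).
by rewrite big_cons RintegralD// IH.
Qed.

Lemma pairing_dt u ut h h' : weak_derivative T [:: e_t] u ut ->
  (forall k, Cn k h) -> tsupp h -> (forall t : R, is_derive t 1 h (h' t)) ->
  pairing u h' = - pairing ut h.
Proof.
move=> wt Ch bh dh.
have := wt _ (mode_test_function a0 bT Ch bh Ce pe).
by rewrite (derive_mode_t dh de) expr1 mulN1r.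
Qed.

Lemma pairing_laplacian u D2u h h' :
  (forall i j, Lp (D2u i j)) ->
  (forall i j, weak_derivative T [:: e_x i; e_x j] u (D2u i j)) ->
  Lp u ->
  (forall k, Cn k h) -> tsupp h -> (forall t : R, is_derive t 1 h (h' t)) ->
  pairing (laplacian D2u) h = - lam * pairing u h.
Proof.
move=> LD wx Lu Ch bh dh.
rewrite /pairing /laplacian.
under eq_Rintegral do rewrite mulr_suml.
rewrite (Rintegral_sum _ (fun i => pairing_integrable (LD i i) bh)).2.
have wi i : \int[cyl]_z (D2u i i z * mode h e z) =
    (i == ord0)%:R * (- lam * pairing u h).
  have := wx i i _ (mode_test_function a0 bT Ch bh Ce pe).
  rewrite (derive_mode_xx _ dh de de') expr2 mulrNN !mul1r => <-.
  rewrite mulrA /pairing -RintegralZl//; last exact: pairing_integrable.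
  by apply: eq_Rintegral => z _; rewrite /mode; ring.
under eq_bigr do rewrite wi.
by rewrite big_ord_recl/= big1 ?addr0 ?mul1r// => i _; rewrite mul0r.
Qed.

Lemma laplacian_pairing_integrable D2u h : (forall i j, Lp (D2u i j)) -> tsupp h ->
  cyl.-integrable setT (EFin \o (fun z => laplacian D2u z * mode h e z)).
Proof.
move=> LD bh; rewrite /laplacian.
rewrite (_ : (fun z => _) = fun z => \sum_(i < N) (D2u i i z * mode h e z)).
  exact: (Rintegral_sum _ (fun i => pairing_integrable (LD i i) bh)).1.
by apply/funext => z; rewrite mulr_suml.
Qed.

Lemma pairing_aeD f g k h :
  cyl.-integrable setT (EFin \o (fun z => f z * mode h e z)) ->
  cyl.-integrable setT (EFin \o (fun z => g z * mode h e z)) ->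
  cyl.-integrable setT (EFin \o (fun z => k z * mode h e z)) ->
  {ae cyl, forall z, f z = g z + k z} -> pairing f h = pairing g h + pairing k h.
Proof.
move=> If Ig Ik fgk; rewrite /pairing -RintegralD//.
rewrite /Rintegral; congr fine; apply: ae_eq_integral => //.
- exact: measurable_int If.
- exact: measurable_int (integrableD measurableT Ig Ik).
- apply: (@filterS _ _ (ae_filter_ringOfSetsType cyl)) fgk => z /= -> _.
  by rewrite mulrDl.
Qed.

(** The weak form of u_k' = lam u_k, where u_k is the coefficient of u along the
    eigenfunction e. *)
Lemma pairing_backward u ut Du D2u h h' : W21p T p u ut Du D2u ->
  {ae cyl, forall z, - ut z - laplacian D2u z = 0} ->
  (forall k, Cn k h) -> tsupp h -> (forall t : R, is_derive t 1 h (h' t)) ->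
  pairing u h' = - lam * pairing u h.
Proof.
move=> Wu eq_u Ch bh dh.
rewrite (pairing_dt (W21p_dt Wu) Ch bh dh).
rewrite -(pairing_laplacian (W21p_dxx_Lp Wu) (W21p_dxx Wu) (W21p_Lp Wu) Ch bh dh).
have zero0 : (fun z : 'rV[R]_N * R => (0 : R) * mode h e z) = fun=> 0.
  by apply/funext => z; rewrite mul0r.
have : pairing (fun=> 0) h = pairing ut h + pairing (laplacian D2u) h.
  apply: pairing_aeD.
  - by rewrite zero0; exact: (@integrable0 _ _ _ cyl).
  - exact: pairing_integrable (W21p_dt_Lp Wu) bh.
  - exact: laplacian_pairing_integrable (W21p_dxx_Lp Wu) bh.
  - by apply: (@filterS _ _ (ae_filter_ringOfSetsType cyl)) eq_u => z /=; lra.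
rewrite [pairing (fun=> 0) h](_ : _ = 0); first lra.
by rewrite /pairing zero0 /Rintegral integral0.
Qed.

(** The weak form of m_k' = - lam m_k - lam u_k. *)
Lemma pairing_forward u ut Du D2u m mt Dm D2m h h' :
  W21p T p u ut Du D2u -> W21p T p m mt Dm D2m ->
  {ae cyl, forall z, mt z - laplacian D2m z = laplacian D2u z} ->
  (forall k, Cn k h) -> tsupp h -> (forall t : R, is_derive t 1 h (h' t)) ->
  pairing m h' = lam * pairing m h + lam * pairing u h.
Proof.
move=> Wu Wm eq_m Ch bh dh.
rewrite (pairing_dt (W21p_dt Wm) Ch bh dh).
have Lm := pairing_laplacian (W21p_dxx_Lp Wm) (W21p_dxx Wm) (W21p_Lp Wm) Ch bh dh.
have Lu := pairing_laplacian (W21p_dxx_Lp Wu) (W21p_dxx Wu) (W21p_Lp Wu) Ch bh dh.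
have -> : pairing mt h = pairing (laplacian D2m) h + pairing (laplacian D2u) h.
  apply: pairing_aeD.
  - exact: pairing_integrable (W21p_dt_Lp Wm) bh.
  - exact: laplacian_pairing_integrable (W21p_dxx_Lp Wm) bh.
  - exact: laplacian_pairing_integrable (W21p_dxx_Lp Wu) bh.
  - by apply: (@filterS _ _ (ae_filter_ringOfSetsType cyl)) eq_m => z /=; lra.
by rewrite Lm Lu; ring.
Qed.

Definition sinh (t : R) : R := 2^-1 * (expR (lam * t) - expR (- lam * t)).

Definition cosh (t : R) : R := 2^-1 * (expR (lam * t) + expR (- lam * t)).

Lemma Cn_exp_scale k (w : R) : Cn k (fun t : R => expR (w * t)).
Proof. by apply: Cn_comp; [exact: Cn_expR|exact: Cn_scale]. Qed.

Lemma is_derive_exp_scale (w t : R) :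
  is_derive t 1 (fun t : R => expR (w * t)) (w * expR (w * t)).
Proof.
have d1 := is_derive_scale w t.
apply: (is_derive_eq (@is_derive1_comp _ expR _ _ _ _ (is_derive_expR _) d1)).
by rewrite mulrC.
Qed.

Lemma Cn_cosh k : Cn k cosh.
Proof. by apply: CnM; [exact: Cn_cst|apply: CnD; exact: Cn_exp_scale]. Qed.

Lemma Cn_sinh k : Cn k sinh.
Proof.
apply: CnM; first exact: Cn_cst.
under eq_fun do rewrite -mulN1r; apply: CnD; first exact: Cn_exp_scale.
by apply: CnM; [exact: Cn_cst|exact: Cn_exp_scale].
Qed.

Lemma is_derive_sinh (t : R) : is_derive t 1 sinh (lam * cosh t).
Proof.
apply: (is_derive_eq (is_deriveZ 2^-1 (is_deriveB
  (is_derive_exp_scale lam t) (is_derive_exp_scale (- lam) t)))).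
by rewrite /cosh /GRing.scale/=; ring.
Qed.

(** The quantity exp(lam t) m_k + sinh(lam t) u_k is constant in time: its
    derivative is exp(lam t) (- lam u_k) + lam (cosh + sinh)(lam t) u_k = 0.  In
    weak form, the forward equation is tested against exp(lam t) psi and the
    backward one against sinh(lam t) psi. *)
Lemma conservation u ut Du D2u m mt Dm D2m psi dpsi :
  W21p T p u ut Du D2u -> W21p T p m mt Dm D2m ->
  {ae cyl, forall z, - ut z - laplacian D2u z = 0} ->
  {ae cyl, forall z, mt z - laplacian D2m z = laplacian D2u z} ->
  (forall k, Cn k psi) -> tsupp psi -> tsupp dpsi ->
  (forall t : R, is_derive t 1 psi (dpsi t)) ->
  pairing m (fun t => expR (lam * t) * dpsi t)
    + pairing u (fun t => sinh t * dpsi t) = 0.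
Proof.
move=> Wu Wm eq_u eq_m Cpsi bpsi bdpsi dpsiE.
have Lu := W21p_Lp Wu; have Lm := W21p_Lp Wm.
have cE : continuous (fun t : R => expR (lam * t)).
  exact: (Cn_continuous (Cn_exp_scale 0%N lam)).
have cS := Cn_continuous (Cn_sinh 0%N); have cC := Cn_continuous (Cn_cosh 0%N).
have bE := tsuppM cE bpsi; have bE' := tsuppM cE bdpsi.
have bS := tsuppM cS bpsi; have bS' := tsuppM cS bdpsi; have bC := tsuppM cC bpsi.
have clam : continuous (fun _ : R => lam) by exact: cst_continuous.
have fwd : pairing m (fun t => expR (lam * t) * dpsi t) =
    lam * pairing u (fun t => expR (lam * t) * psi t).
  have := @pairing_forward _ _ _ _ _ _ _ _ (fun t => expR (lam * t) * psi t)
    (fun t => lam * (expR (lam * t) * psi t) + expR (lam * t) * dpsi t) Wu Wm eq_m.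
  rewrite pairingD ?pairingZ//; last exact: tsuppM.
  have H : (forall k, Cn k (fun t => expR (lam * t) * psi t)).
    by move=> k; apply: CnM => //; exact: Cn_exp_scale.
  move=> /(_ H bE) H2; apply: (@addrI _ (lam * pairing m (fun t => expR (lam * t) * psi t))).
  apply: H2 => t.
  apply: (is_derive_eq (is_deriveM (is_derive_exp_scale lam t) (dpsiE t))).
  by rewrite /GRing.scale/=; ring.
have bwd : pairing u (fun t => sinh t * dpsi t) =
    - lam * pairing u (fun t => cosh t * psi t) - lam * pairing u (fun t => sinh t * psi t).
  have := @pairing_backward _ _ _ _ (fun t => sinh t * psi t)
    (fun t => lam * (cosh t * psi t) + sinh t * dpsi t) Wu eq_u.
  rewrite pairingD ?pairingZ//; last exact: tsuppM.
  have H : (forall k, Cn k (fun t => sinh t * psi t)).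
    by move=> k; apply: CnM => //; exact: Cn_sinh.
  move=> /(_ H bS) H2.
  have : lam * pairing u (fun t => cosh t * psi t) + pairing u (fun t => sinh t * dpsi t) =
    - lam * pairing u (fun t => sinh t * psi t).
    apply: H2 => t.
    apply: (is_derive_eq (is_deriveM (is_derive_sinh t) (dpsiE t))).
    by rewrite /GRing.scale/=; ring.
  by lra.
rewrite fwd bwd.
have -> : (fun t => expR (lam * t) * psi t) = (fun t => cosh t * psi t + sinh t * psi t).
  by apply/funext => t; rewrite /cosh /sinh; field.
by rewrite pairingD//; ring.
Qed.

End pairing.

(** * Reading off the boundary values *)

Section concentration.
Context {R : realType} {n : nat}.
Local Notation N := n.+1.
Local Notation mu := (@lebesgue_measure R).
Local Notation cyl := (@cylinder_measure R N).
Local Notation Z := ('rV[R]_N * measurableTypeR R)%type.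

Lemma integral_mrestr d (X : measurableType d) (nu : {measure set X -> \bar R})
    (D : set X) (mD : measurable D) (f : X -> \bar R) :
  (mrestr nu mD).-integrable setT f ->
  (\int[mrestr nu mD]_x f x = \int[nu]_(x in D) f x)%E.
Proof.
move=> intf; rewrite (@negligible_integral _ _ _ _ setT (~` D))//; last 2 first.
- exact: measurableC.
- have : nu (~` D `&` D) = 0%E by rewrite setICl measure0.
  by [].
rewrite setTD setCK; apply: eq_measure_integral => A mA AD.
by have : nu (A `&` D) = nu A by rewrite setIidl.
Qed.

Lemma Rintegral_cylinder_product (T M K : R) (q rho : R -> R) :
  continuous q -> continuous rho -> (forall t, `|q t| <= K) -> (forall t, `|rho t| <= M) ->
  \int[cyl T]_z (q ((z : Z).1 ord0 ord0) * rho z.2) =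
  (\int[torus_measure N]_x q (x ord0 ord0)) * \int[mu]_(t in `]0, T[) rho t.
Proof.
move=> cq cr qK rM.
have mI : measurable (`]0, T[ : set (measurableTypeR R)) by exact: measurable_itv.
have Ioo : (mu `]0%R, T[%classic < +oo)%E.
  by rewrite lebesgue_measure_itv/=; case: ifP; rewrite ltry.
pose nu : {finite_measure set (measurableTypeR R) -> \bar R} := mfrestr mI Ioo.
have mr : measurable_fun setT rho by exact: continuous_measurable_fun.
have inu : nu.-integrable setT (EFin \o rho).
  apply: measurable_bounded_integrable => //.
    by rewrite /nu /= /mfrestr /mrestr setTI.
  exists M; split; first exact: num_real.
  by move=> x x1 y _; exact: le_trans (rM y) (ltW x1).
have iq : (torus_measure N).-integrable setT (EFin \o (fun x : 'rV[R]_N => q (x ord0 ord0))).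
  by apply: (@bounded_torus_integrable _ _ _ K) => //; exact: continuous_coord_measurable.
have cylE (A : set Z) : measurable A -> A `<=` setT ->
    cyl T A = (torus_measure N \x nu)%E A.
  move=> mA _; apply/esym; apply: product_measure_unique => // B C mB mC.
  exact: cylinder_measureX.
pose F (z : Z) := ((q (z.1 ord0 ord0) * rho z.2)%:E).
have mF : measurable_fun setT F.
  apply/measurable_EFinP; apply: measurable_funM.
    apply: (measurableT_comp (@continuous_coord_measurable _ n q cq)).
    exact: measurable_fst.
  by apply: (measurableT_comp mr); exact: measurable_snd.
have iF : (torus_measure N \x nu)%E.-integrable setT F.
  apply: measurable_bounded_integrable => //.
  - have : (cyl T setT < +oo)%E by exact: cylinder_measureT.
    by rewrite cylE.
  - exact/measurable_EFinP.
  - exists (K * M); split; first exact: num_real.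
    move=> x x1 y _; apply: le_trans (ltW x1).
    by rewrite normrM ler_pM.
rewrite /Rintegral (eq_measure_integral (torus_measure N \x nu)%E)//.
rewrite -(integral12_prod_meas1 iF) /fubini_F /F /=.
have rfin : (\int[nu]_t (rho t)%:E)%E = (\int[mu]_(t in `]0%R, T[) (rho t)%:E)%E.
  exact: (integral_mrestr inu).
have rfn : (\int[nu]_t (rho t)%:E)%E \is a fin_num by exact: integrable_fin_num inu.
rewrite (eq_integral (fun x : 'rV[R]_N => (q (x ord0 ord0))%:E * \int[nu]_t (rho t)%:E)%E);
    last first.
  move=> x _; rewrite -integralZl//.
rewrite -(fineK rfn) integralZr// fineM//; last first.
  exact: integrable_fin_num iq.
by rewrite rfin.
Qed.

(** If F is within eps * rho of the separated function q(x_1) rho(t), where rho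
    has mass one, then its integral is within eps of the space integral of q.
    This reads off boundary values when rho concentrates near an end of the time
    interval. *)
Lemma Rintegral_concentrated (T M K eps : R) (q rho : R -> R) (F : Z -> R) : 0 <= eps ->
  continuous q -> continuous rho -> (forall t, `|q t| <= K) -> (forall t, `|rho t| <= M) ->
  (forall t, 0 <= rho t) -> \int[mu]_(t in `]0, T[) rho t = 1 ->
  (cyl T).-integrable setT (EFin \o F) ->
  {ae cyl T, forall z, `|F z - q (z.1 ord0 ord0) * rho z.2| <= eps * rho z.2} ->
  `|\int[cyl T]_z F z - \int[torus_measure N]_x q (x ord0 ord0)| <= eps.
Proof.
move=> eps0 cq cr qK rM r0 r1 iF Fq.
have prodint (g : R -> R) (L : R) : continuous g -> (forall t, `|g t| <= L) ->
    (cyl T).-integrable setT (EFin \o (fun z : Z => g (z.1 ord0 ord0) * rho z.2)).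
  move=> cg gL; apply: (@bounded_cylinder_integrable _ _ _ _ (L * M)).
    apply: measurable_funM.
      apply: (measurableT_comp (@continuous_coord_measurable _ n g cg)).
      exact: measurable_fst.
    by apply: (measurableT_comp (continuous_measurable_fun cr)); exact: measurable_snd.
  by move=> z; rewrite normrM ler_pM.
have iq := prodint _ _ cq qK.
have ceps : continuous (fun _ : R => eps) by exact: cst_continuous.
have ie := prodint (fun=> eps) `|eps| ceps (fun=> lexx _).
have := Rintegral_cylinder_product T cq cr qK rM; rewrite r1 mulr1 => <-.
rewrite -RintegralB//.
have iD : (cyl T).-integrable setT
    (EFin \o (fun z : Z => F z - q (z.1 ord0 ord0) * rho z.2)).
  exact: (integrableB measurableT iF iq).
apply: (le_trans (le_normr_Rintegral measurableT iD)).
have Ie : \int[cyl T]_z (eps * rho z.2) = eps.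
  rewrite (Rintegral_cylinder_product T ceps cr (fun=> lexx _) rM) r1 mulr1.
  exact: Rintegral_torus_cst.
rewrite -[leRHS]Ie /Rintegral fine_le//.
- exact: (integrable_fin_num measurableT (integrable_norm iD)).
- exact: (integrable_fin_num measurableT ie).
- apply: ae_ge0_le_integral => //.
  + exact: (measurable_int _ (integrable_norm iD)).
  + by move=> z _; rewrite lee_fin mulr_ge0.
  + exact: (measurable_int _ ie).
  + apply: (@filterS _ _ (ae_filter_ringOfSetsType (cyl T))) Fq => z /= h _.
    by rewrite lee_fin.
Qed.

Lemma ae_cylinder_cube (T : R) :
  {ae cyl T, forall z : Z, cube z.1 /\ 0 < z.2 < T}.
Proof.
suff : (cyl T).-negligible (~` [set z : Z | cube z.1 /\ 0 < z.2 < T]) by [].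
apply: (@negligibleS _ _ _ (cyl T)
  ((~` (@cube R N)) `*` setT `|` setT `*` ~` `]0, T[%classic)).
  move=> [x t] /= /not_andP[xc|tT]; [left|right]; split => //.
have mc : measurable (~` (@cube R N)) by apply: measurableC; exact: measurable_cube.
have mI : measurable (~` `]0, T[%classic : set (measurableTypeR R)).
  by apply: measurableC; exact: measurable_itv.
apply: negligibleU.
- exists ((~` (@cube R N)) `*` setT); split => //; first exact: measurableX.
  rewrite -[LHS]/(cyl T _) cylinder_measureX//.
  have -> : torus_measure N (~` (@cube R N)) = 0%E.
    rewrite probability_setC; last exact: measurable_cube.
    by rewrite [X in (1 - X)%E]torus_measure_cube subee.
  by rewrite mul0e.
- exists (setT `*` ~` `]0, T[%classic); split => //; first exact: measurableX.
  rewrite -[LHS]/(cyl T _) cylinder_measureX// setICl measure0 mule0//.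
Qed.

(** Continuity up to a time s is uniform in space, by compactness of the unit
    cube. *)
Lemma cube_uniform (T s eps : R) (F : 'rV[R]_N * R -> R) : 0 <= s <= T -> 0 < eps ->
  {within [set z | 0 <= z.2 <= T], continuous F} ->
  exists2 delta, 0 < delta & forall x t, cube x -> 0 <= t <= T -> `|t - s| < delta ->
    `|F (x, t) - F (x, s)| <= eps.
Proof.
move=> sT e0 cF.
have Kc : compact (@cube R N).
  have := @rV_compact R N (fun=> `[0, 1]%classic) (fun=> @segment_compact R 0 1).
  congr compact; apply/seteqP; split => x /= cx i; have := cx i; by rewrite in_itv.
pose P (t : R) (x : 'rV[R]_N) := 0 <= t <= T -> `|F (x, t) - F (x, s)| <= eps.
have H x : cube x -> \forall x' \near x & t \near nbhs s, P t x'.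
  move=> _.
  have /subspace_continuousP/(_ (x, s) sT)/cvgrPdist_lt/(_ (eps / 2)) := cF.
  have e2 : 0 < eps / 2 by rewrite divr_gt0.
  move=> /(_ e2); rewrite near_withinE => -[[A B] /= [nA nB] AB].
  exists (A, B) => //= -[x' t] /= [Ax' Bt] tT.
  have := AB (x', t) (conj Ax' Bt) tT.
  have := AB (x', s) (conj Ax' (nbhs_singleton nB)) sT.
  rewrite /= => h1 h2.
  have -> : F (x', t) - F (x', s) = (F (x, s) - F (x', s)) - (F (x, s) - F (x', t)) by ring.
  rewrite (le_trans (ler_normB _ _))// [leRHS](splitr eps).
  by rewrite lerD// ltW.
have /compact_near_coveringP/(_ R (nbhs s) P _ H)[d /= d0 dP] := Kc.
exists d => // x t cx tT ts.
by apply: (dP t) => //; rewrite /ball_ /= distrC.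
Qed.

End concentration.

(** * The critical times *)

Section obstruction.
Context {R : realType} {n : nat}.
Local Notation N := n.+1.
Implicit Types (k : nat).

Definition freq k : R := 2 * pi * k%:R.

Lemma wave_periodic k : periodic (@wave R k) 1.
Proof.
move=> t; rewrite /wave mulrDr mulr1.
have -> : 2 * pi * k%:R = (pi *+ 2) *+ k :> R by rewrite -[2]/(2%:R) mulr_natl mulr_natr.
exact: (periodicn (@cosD2pi R)).
Qed.

Lemma is_derive_wave k (t : R) :
  is_derive t 1 (@wave R k) (- freq k * sin (freq k * t)).
Proof.
have d1 := is_derive_scale (freq k) t.
apply: (is_derive_eq (@is_derive1_comp _ cos _ _ _ _ (is_derive_cos _) d1)).
by ring.
Qed.

Lemma is_derive_dwave k (t : R) :
  is_derive t 1 (fun t : R => - freq k * sin (freq k * t)) (- freq k ^+ 2 * wave k t).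
Proof.
have d1 := is_derive_scale (freq k) t.
have d2 := @is_derive1_comp _ sin _ _ _ _ (is_derive_sin _) d1.
apply: (is_derive_eq (is_deriveZ (- freq k) d2)).
by rewrite /GRing.scale/= /wave -/(freq k); ring.
Qed.

Definition initial_datum (x : 'rV[R]_N) : R := poisson (x ord0 ord0).

Lemma smooth_initial_datum : smooth initial_datum.
Proof.
apply: Cn_smooth => k; apply: Cn_comp; first exact: Cn_poisson.
by apply: Cn_linear; [exact: coord_continuous|move=> c v x; rewrite !mxE].
Qed.

Lemma periodic_initial_datum : torus_periodic initial_datum.
Proof.
move=> i x; rewrite /initial_datum /poisson !mxE eqxx /=.
case: eqP => _; last by rewrite addr0.
by rewrite mulrDr mulr1 [2 * pi]mulr_natl cosD2pi.
Qed.

(** The conserved quantity equals the k-th coefficient of the initial datum at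
    time 0, while at time T the final condition turns it into
    m_k(T) (exp(lam T) + alpha sinh(lam T)), whose second factor is 0 by hypothesis.
    The two bumps of plateau make this rigorous for weak solutions. *)
Lemma solvable_fourier_eq0 (alpha T : R) k : 0 < T ->
  expR (freq k ^+ 2 * T) + alpha * sinh (freq k ^+ 2) T = 0 ->
  solvable alpha initial_datum T -> @fourier R n k = 0.
Proof.
set lam := freq k ^+ 2 => T0 balance.
move=> [p [u [m [pN [ut [Du [D2u [mt [Dm [D2m [Wu Wm eq_u eq_m]]]]]]]]]]].
move=> [uc [mc [[_ cuc u_uc] [_ cmc m_mc] final init]]].
have p1 : 1 <= p by rewrite (le_trans _ (ltW pN))// natrD -[leLHS]add0r lerD// ler1n.
have Ce i := @Cn_wave R i k.
have Kw := @normr_wave R k.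
have Lu := W21p_Lp Wu; have Lm := W21p_Lp Wm.
pose ex (t : R) := expR (lam * t); pose sh := sinh lam.
have cex : continuous ex by exact: (Cn_continuous (Cn_exp_scale 0%N lam)).
have csh : continuous sh by exact: (Cn_continuous (Cn_sinh lam 0%N)).
(* The density of the conserved quantity, for the continuous representatives. *)
pose W (z : 'rV[R]_N * R) := (mc z * ex z.2 + uc z * sh z.2) * wave k (z.1 ord0 ord0).
have cW : {within [set z | 0 <= z.2 <= T], continuous W}.
  have ctime (g : R -> R) : continuous g ->
      {within [set z : 'rV[R]_N * R | 0 <= z.2 <= T], continuous (fun z => g z.2)}.
    move=> cg; apply: continuous_subspaceT => z.
    by apply: (@continuous_comp _ _ _ snd g); [exact: cvg_snd|exact: cg].
  have cwave : {within [set z : 'rV[R]_N * R | 0 <= z.2 <= T],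
      continuous (fun z => wave k (z.1 ord0 ord0))}.
    apply: continuous_subspaceT => z.
    apply: (@continuous_comp _ _ _ (fun z : 'rV[R]_N * R => z.1 ord0 ord0) (wave k)).
      exact: continuous_coord0.
    exact: (Cn_continuous (Ce 0%N)).
  move=> z; apply: cvgM; last exact: cwave.
  apply: cvgD; apply: cvgM; [exact: cmc|exact: (ctime _ cex)|exact: cuc|exact: (ctime _ csh)].
pose q (t : R) := poisson t * wave k t.
have W0 x : W (x, 0) = q (x ord0 ord0).
  by rewrite /W /= init /ex /sh /sinh !mulr0 expR0 subrr mulr0 mulr1 mulr0 addr0.
have WT x : W (x, T) = 0.
  rewrite /W /= final.
  have -> : mc (x, T) * ex T + alpha * mc (x, T) * sh T =
    mc (x, T) * (ex T + alpha * sh T) by ring.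
  by rewrite /ex /sh balance mulr0 mul0r.
apply/eqP; apply/negP => /negP c0.
set c := fourier k in c0 *.
pose eps := `|c| / 4.
have eps0 : 0 < eps by rewrite divr_gt0// normr_gt0.
have T00 : 0 <= (0 : R) <= T by rewrite lexx ltW.
have T01 : 0 <= T <= T by rewrite lexx ltW.
have [d1 d10 near0] := cube_uniform T00 eps0 cW.
have [d2 d20 nearT] := cube_uniform T01 eps0 cW.
pose d := Num.min (Num.min d1 d2) T / 8.
have d0 : 0 < d by rewrite divr_gt0// !lt_min d10 d20.
have dT : 8 * d <= T by rewrite mulrC divfK// ge_min lexx orbT.
have dd1 : 8 * d <= d1 by rewrite mulrC divfK// !ge_min lexx.
have dd2 : 8 * d <= d2 by rewrite mulrC divfK// !ge_min lexx !orbT.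
have dT4 : 4 * d <= T by lra.
have [psi [rho0 [rhoT [Cpsi psi0 dpsi h0 hT]]]] := plateau d0 dT4.
have [c_0 ge0 s_0 i_0] := h0; have [c_T geT s_T i_T] := hT.
have bpsi : tsupp d (T - d) psi by split; [exact: (Cn_continuous (Cpsi 0%N))|].
have b0 : tsupp d (T - d) rho0.
  by split=> // t h; apply: s_0; apply: contra h => /andP[? ?]; apply/andP; split; lra.
have bT : tsupp d (T - d) rhoT.
  by split=> // t h; apply: s_T; apply: contra h => /andP[? ?]; apply/andP; split; lra.
have bd : tsupp d (T - d) (fun t => rho0 t - rhoT t).
  split=> [t|t h]; first by apply: cvgB; [exact: c_0|exact: c_T].
  by rewrite b0.2// bT.2// subr0.
have TdT : T - d < T by lra.
have de := @is_derive_wave k.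
have de' (t : R) : is_derive t 1
    (fun t : R => - freq k * sin (freq k * t)) (- lam * wave k t).
  exact: is_derive_dwave.
have cons := conservation p1 d0 TdT Ce (wave_periodic k) de de' Kw
  Wu Wm eq_u eq_m Cpsi bpsi bd dpsi.
pose A rho := pairing T (wave k) m (fun t => ex t * rho t) +
  pairing T (wave k) u (fun t => sh t * rho t).
have pint f h := @pairing_integrable R n T p d (T - d) (wave k) p1 Ce 1 Kw f h.
have AE rho : tsupp d (T - d) rho ->
    (cylinder_measure T).-integrable setT (EFin \o (fun z =>
      (m z * ex z.2 + u z * sh z.2) * wave k (z.1 ord0 ord0) * rho z.2)) /\
    A rho = \int[cylinder_measure T]_z
      ((m z * ex z.2 + u z * sh z.2) * wave k (z.1 ord0 ord0) * rho z.2).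
  move=> br.
  have I1 := pint m _ Lm (tsuppM cex br); have I2 := pint u _ Lu (tsuppM csh br).
  have E : (fun z : 'rV[R]_N * R =>
      (m z * ex z.2 + u z * sh z.2) * wave k (z.1 ord0 ord0) * rho z.2) =
    (fun z => m z * mode (fun t => ex t * rho t) (wave k) z +
      u z * mode (fun t => sh t * rho t) (wave k) z).
    by apply/funext => z; rewrite /mode; ring.
  rewrite E; split; first exact: (integrableD measurableT I1 I2).
  by rewrite RintegralD.
(* The derivative of the cut-off is rho0 - rhoT, so conservation equates the
   averages of the conserved quantity near 0 and near T. *)
have A0T : A rho0 = A rhoT.
  apply/eqP; rewrite -subr_eq0; apply/eqP; rewrite -[RHS]cons /A.
  have E (g : R -> R) :
      (fun t => g t * (rho0 t - rhoT t)) = fun t => g t * rho0 t - g t * rhoT t.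
    by apply/funext => t; rewrite mulrBr.
  rewrite !E !(pairingB p1 Ce Kw (a := d) (b := T - d))//; try exact: tsuppM.
  by rewrite opprD addrACA.
have [I0 A0] := AE _ b0; have [IT AT] := AE _ bT.
have ae_all : {ae cylinder_measure T, forall z : 'rV[R]_N * measurableTypeR R,
    [/\ u z = uc z, m z = mc z, cube z.1 & 0 < z.2 < T]}.
  have F := ae_filter_ringOfSetsType (@cylinder_measure R N T).
  apply: (@filterS3 _ _ F) u_uc m_mc (@ae_cylinder_cube R n T) => z /= ? ? [? ?].
  by split.
have cq : continuous q by exact: continuous_poisson_wave.
have qK t : `|q t| <= 1 by exact: normr_poisson_wave.
have [M0 M0b] := tsupp_bounded b0; have [MT MTb] := tsupp_bounded bT.
have est0 : `|A rho0 - c| <= eps.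
  rewrite A0; apply: (Rintegral_concentrated (ltW eps0) cq c_0 qK M0b ge0 i_0 I0).
  have F := ae_filter_ringOfSetsType (@cylinder_measure R N T).
  apply: (@filterS _ _ F) ae_all => -[x t] /= [-> -> cx /andP[t0 tT]].
  rewrite -mulrBl normrM (ger0_norm (ge0 t)).
  have [h|h] := boolP (d <= t <= 2 * d); last by rewrite s_0// !mulr0.
  rewrite ler_wpM2r// -W0; move: h => /andP[h1 h2].
  apply: near0 => //; first by rewrite (ltW t0) (ltW tT).
  by rewrite subr0 ger0_norm ?(ltW t0)//; lra.
have estT : `|A rhoT - 0| <= eps.
  have -> : (0 : R) = \int[torus_measure N]_x (0 : R) by rewrite Rintegral_torus_cst.
  rewrite AT; apply: (@Rintegral_concentrated R n T MT 1 eps (fun=> 0) rhoT _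
    (ltW eps0) _ c_T _ MTb geT i_T IT).
  - exact: cst_continuous.
  - by move=> t; rewrite normr0.
  have F := ae_filter_ringOfSetsType (@cylinder_measure R N T).
  apply: (@filterS _ _ F) ae_all => -[x t] /= [-> -> cx /andP[t0 tT]].
  rewrite -mulrBl normrM (ger0_norm (geT t)).
  have [h|h] := boolP (T - 2 * d <= t <= T - d); last by rewrite s_T// !mulr0.
  rewrite ler_wpM2r// -(WT x); move: h => /andP[h1 h2].
  apply: nearT => //; first by rewrite (ltW t0) (ltW tT).
  by rewrite ler0_norm; lra.
(* As eps = |c| / 4, this contradicts c <> 0. *)
have : `|c| <= 2 * eps.
  have -> : c = (A rhoT - 0) - (A rho0 - c) by rewrite A0T; ring.
  by rewrite (le_trans (ler_normB _ _))// mulr2n mulrDl mul1r lerD.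
rewrite /eps; have : 0 < `|c| by rewrite normr_gt0.
by lra.
Qed.

(** For k > 0, the positive root T of exp(lam T) + alpha sinh(lam T) = 0 with
    lam = (freq k)^2, that is, of exp(2 lam T) = alpha / (alpha + 2).  It exists
    because alpha < -2 makes this ratio larger than 1. *)
Definition critical_time (alpha : R) k : R :=
  ln (alpha / (alpha + 2)) / (2 * freq k ^+ 2).

Lemma freq_gt0 k : (0 < k)%N -> 0 < freq k.
Proof. by move=> k0; rewrite !mulr_gt0 ?pi_gt0 ?ltr0n. Qed.

Lemma critical_ratio_gt1 (alpha : R) : alpha < - 2 -> 1 < alpha / (alpha + 2).
Proof.
move=> a2; have a20 : alpha + 2 < 0 by lra.
by rewrite ltr_ndivlMr// mul1r; lra.
Qed.

Lemma critical_time_gt0 (alpha : R) k : alpha < - 2 -> (0 < k)%N -> 0 < critical_time alpha k.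
Proof.
move=> a2 k0; rewrite divr_gt0 ?ln_gt0 ?critical_ratio_gt1//.
by rewrite mulr_gt0// exprn_gt0// freq_gt0.
Qed.

Lemma critical_time_balance (alpha : R) k : alpha < - 2 -> (0 < k)%N ->
  expR (freq k ^+ 2 * critical_time alpha k)
    + alpha * sinh (freq k ^+ 2) (critical_time alpha k) = 0.
Proof.
move=> a2 k0; rewrite /sinh mulNr expRN.
have f0 : freq k != 0 by rewrite gt_eqF// freq_gt0.
have -> : freq k ^+ 2 * critical_time alpha k = ln (alpha / (alpha + 2)) / 2.
  by rewrite /critical_time; field.
set E := expR _.
have E0 : 0 < E by exact: expR_gt0.
have EE : E * E = alpha / (alpha + 2).
  rewrite /E -expRD -splitr lnK// posrE.
  by rewrite (lt_trans ltr01)// critical_ratio_gt1.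
have a20 : alpha + 2 != 0 by rewrite lt_eqF//; lra.
have h : (alpha + 2) * (E * E) = alpha by rewrite EE mulrC divfK.
have E0' : E != 0 by rewrite gt_eqF.
apply: (mulfI E0'); rewrite mulr0.
have -> : E * (E + alpha * (2^-1 * (E - E^-1))) =
  2^-1 * ((alpha + 2) * (E * E) - alpha) by field.
by rewrite h subrr mulr0.
Qed.

(** A crude bound of order 1 / k, enough for the convergence to 0. *)
Lemma critical_time_le (alpha : R) k : alpha < - 2 -> (0 < k)%N ->
  critical_time alpha k <= ln (alpha / (alpha + 2)) / k%:R.
Proof.
move=> a2 k0; have L0 : 0 < ln (alpha / (alpha + 2)) by rewrite ln_gt0// critical_ratio_gt1.
have kR : 1 <= k%:R :> R by rewrite ler1n.
have fk : k%:R <= freq k.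
  rewrite /freq -[leLHS]mul1r ler_wpM2r//.
  by have := @pi_ge2 R; lra.
rewrite /critical_time ler_pM2l// lef_pV2 ?posrE ?ltr0n//; last first.
  by rewrite mulr_gt0// exprn_gt0// freq_gt0.
rewrite (le_trans fk)// expr2.
have f1 : 1 <= freq k by exact: le_trans fk.
by nra.
Qed.

End obstruction.

Theorem mainTheorem4 (R : realType) (N : nat) (hN : (1 <= N)%N)
    (alpha : R) (halpha : alpha < - 2) :
  exists (m0 : 'rV[R]_N -> R) (T_ : nat -> R),
    [/\ smooth m0, torus_periodic m0,
        forall k, 0 < T_ k,
        T_ k @[k --> \oo] --> (0 : R) &
        forall k, ~ solvable alpha m0 (T_ k)].
Proof.
case: N hN => // n _.
have /choice[j jP] : forall k, exists i, (k < i)%N /\ @fourier R n i != 0.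
  by move=> k; have [i ki fi] := @fourier_neq0 R n k; exists i.
have j0 k : (0 < j k)%N by apply: leq_ltn_trans (jP k).1.
exists (@initial_datum R n), (fun k => critical_time alpha (j k)); split.
- exact: smooth_initial_datum.
- exact: periodic_initial_datum.
- by move=> k; exact: critical_time_gt0.
- apply: (@squeeze_cvgr _ _ _ _ (fun=> 0)
    (fun k => ln (alpha / (alpha + 2)) * harmonic k)).
  + near=> k; rewrite (ltW (critical_time_gt0 halpha (j0 k)))/=.
    apply: (le_trans (critical_time_le halpha (j0 k))).
    rewrite ler_pM2l ?ln_gt0 ?critical_ratio_gt1//.
    by rewrite /harmonic lef_pV2 ?posrE ?ltr0n// ler_nat (jP k).1.
  + exact: cvg_cst.
  + rewrite -[X in _ --> X](mulr0 (ln (alpha / (alpha + 2)))).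
    by apply: cvgMr; exact: cvg_harmonic.
- move=> k sol; have /negP := (jP k).2; apply; apply/eqP.
  apply: (solvable_fourier_eq0 _ _ sol); first exact: critical_time_gt0.
  exact: critical_time_balance.
Unshelve. all: by end_near. Qed.
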